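(* Let $r\ge 5$ be an integer. Then $|C(n,r)|=\frac{n^2}{2}-\frac{n^2}{2r}+o(n^2)$ as $n\to\infty$.
   Context: For positive integers $n,r$, let $C(n,r)=\left\{\sum_{i=1}^{r}\binom{n_i}{2}:\ n_1,\dots,n_r \text{ non-negative integers with } \sum_{i=1}^{r}n_i=n\right\}$, i.e. the set of possible edge counts of an $n$-vertex graph that is a disjoint union of at most $r$ cliques. *)

(* Defs.v *)
From HB Require Import structures.
From mathcomp Require Import all_boot all_order all_algebra.
From mathcomp Require Import finmap.
From mathcomp Require Import all_classical all_reals all_analysis.

Set Implicit Arguments.
Unset Strict Implicit.
Unset Printing Implicit Defensive.

Import Order.TTheory GRing.Theory Num.Theory.

Local Open Scope classical_set_scope.

(* The possible numbers of edges of an n-vertex disjoint union of at most r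
   cliques; k i is the order of the i-th clique, 0 being allowed. *)
Definition cliqueEdgeCounts (n r : nat) : set nat :=
  [set m | exists2 k : 'I_r -> nat,
     \sum_(i < r) k i = n & m = \sum_(i < r) 'C(k i, 2)]%N.

(* fset_set below returns the empty set on an infinite argument; this lemma
   shows that it is only applied to finite sets. *)
Lemma finite_cliqueEdgeCounts (n r : nat) :
  finite_set (cliqueEdgeCounts n r).
Proof.
apply: (@sub_finite_set _ _ `I_(r * 'C(n, 2)).+1); last exact: finite_II.
move=> _ [k kn ->] /=.
rewrite ltnS -[X in (_ <= X * _)%N](card_ord r) -sum_nat_const.
apply: leq_sum => i _; apply: leq_bin2l.
by rewrite -kn (bigD1 i) //= leq_addr.
Qed.

Definition numCliqueEdgeCounts (n r : nat) : nat :=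
  #|` fset_set (cliqueEdgeCounts n r)|%fset.

(* Main.v *)
Require Import Defs.
From mathcomp Require Import all_boot all_order all_algebra.
From mathcomp Require Import finmap.
From mathcomp Require Import all_classical all_reals all_analysis.
From mathcomp Require Import zify ring lra.

(* Writing [S = 2 m + n], the edge counts [m] correspond to the values [S] of
   [sum k_i^2] subject to [sum k_i = n]; they have the parity of [n] and lie
   between [n^2 / r] and [n^2].  Conversely every [S] of the right parity which
   is not too close to the ends of this interval is attained: fix all cliques
   but four and apply Cauchy's lemma (if [a], [b] are odd, [b^2 < 4 a] and
   [3 a <= b^2], then some four naturals have sum [b] and sum of squares [a]),
   which rests on the fact that every [N = 3] mod 8 is a sum of three squares.

   For the latter it suffices to find [P] such that [-P] is an invertible square
   mod [N] and [-N] is a square mod [P]: these data yield a unimodular positive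
   definite ternary form representing [N], and such a form is equivalent to
   [x^2 + y^2 + z^2].  Instead of a prime from Dirichlet's theorem, we take
   [P = 2 q] where [q] is the squarefree kernel of an integer
   [m = (N - 1) / 2] mod [2 N] with nonzero [f m = sum_(d | m) chi d], [chi] being
   the Jacobi symbol mod [N] restricted to odd integers.  Such an [m] exists as
   the hyperbola method compares the sum of [f] over this residue class with
   [L(1, chi)], which is positive by Monsky's argument. *)

Set Implicit Arguments.
Unset Strict Implicit.
Unset Printing Implicit Defensive.

Import Order.TTheory GRing.Theory Num.Theory.
Import numFieldNormedType.Exports.

Local Open Scope ring_scope.

(** * Unimodular ternary quadratic forms *)

Lemma centered_residue (a b : int) : 0 < a ->
  exists k : int, - a <= 2 * (b + k * a) <= a.
Proof.
move=> a0; exists (- ((2 * b + a) %/ (2 * a))%Z).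
have := divz_eq (2 * b + a) (2 * a).
have := modz_ge0 (2 * b + a) (_ : 2 * a != 0).
have := ltz_pmod (2 * b + a) (_ : 0 < 2 * a).
set q := (_ %/ _)%Z; set m := (_ %% _)%Z.
move=> /(_ _)/[dup] h1 /(_ ltac:(lia)) h2 /(_ ltac:(lia)) h3 h4.
apply/andP; split; lia.
Qed.

Lemma sqr_centered (a x : int) : - a <= 2 * x <= a -> 4 * x ^+ 2 <= a ^+ 2.
Proof.
move=> xP; have -> : 4 * x ^+ 2 = `|2 * x| ^+ 2 by rewrite real_normK ?num_real //; ring.
by rewrite lerXn2r ?nnegrE ?ler_norml //; lia.
Qed.

(** Lagrange reduction: shear until [4 b^2 <= a^2], and swap whenever [c < a], which lowers [a].
    Once [a <= c], the determinant is at least [a^2 - a^2 / 4]. *)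
Lemma binary_form_reduction (a b c : int) : 0 < a -> 0 < a * c - b ^+ 2 ->
  exists p q r s : int, p * s - q * r = 1 /\
    3 * (a * p ^+ 2 + 2 * b * p * r + c * r ^+ 2) ^+ 2 <= 4 * (a * c - b ^+ 2).
Proof.
have [n] := ubnP `|a|%N; elim: n => // n IHn in a b c * => an a0 d0.
have [k kP] := centered_residue b a0.
pose b1 : int := b + k * a; pose c1 : int := c + 2 * k * b + k ^+ 2 * a.
have dE : a * c1 - b1 ^+ 2 = a * c - b ^+ 2 by rewrite /b1 /c1; ring.
have b1P : 4 * b1 ^+ 2 <= a ^+ 2 by exact: sqr_centered.
have [lt_c1a|le_ac1] := ltP c1 a.
  have c1_gt0 : 0 < c1 by rewrite -(pmulr_rgt0 _ a0); move: (sqr_ge0 b1); lia.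
  have [|||p [q [r [s [detE le4]]]]] := IHn c1 (- b1) a.
  - lia.
  - by [].
  - by rewrite sqrrN mulrC; lia.
  exists (k * p - r), (k * q - s), p, q; split; first by rewrite -detE; ring.
  move: le4; rewrite sqrrN [c1 * a]mulrC dE; congr (_ * _ ^+ 2 <= _).
  by rewrite /b1 /c1; ring.
exists 1, 0, 0, 1; split=> //.
rewrite !(expr1n, expr0n, mulr1, mulr0, addr0) -dE /=.
by move: (ler_wpM2l (ltW a0) le_ac1) b1P; lia.
Qed.

(** Reduction produces a leading coefficient [a'] with [3 a'^2 <= 4], hence [a' = 1]. In the new
    coordinates [y'], [z'] the form is [(y' + b' z')^2 + z'^2]. *)
Lemma binary_unimodular_two_squares (a b c : int) :
  0 < a -> a * c - b ^+ 2 = 1 -> forall y z : int,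
  exists u v : int, a * y ^+ 2 + 2 * b * y * z + c * z ^+ 2 = u ^+ 2 + v ^+ 2.
Proof.
move=> a0 d1 y z.
have [|p [q [r [s [detE le4]]]]] := @binary_form_reduction a b c a0; first by lia.
pose a' : int := a * p ^+ 2 + 2 * b * p * r + c * r ^+ 2.
have a'E : a * a' = (a * p + b * r) ^+ 2 + r ^+ 2.
  transitivity ((a * p + b * r) ^+ 2 + (a * c - b ^+ 2) * r ^+ 2).
    by rewrite /a'; ring.
  by rewrite d1; ring.
have a'1 : a' = 1.
  have a'2 : a' <= 1.
    move: le4; rewrite -/a' d1; clearbody a'; clear => le4.
    by rewrite leNgt; apply/negP => lt1; nia.
  suff : 0 < a' by lia.
  have a'_ge0 : 0 <= a' by rewrite -(pmulr_rge0 _ a0) a'E addr_ge0 ?sqr_ge0.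
  suff : a' != 0 by lia.
  apply/eqP => a'0; move: a'E; rewrite a'0 mulr0 => /esym/eqP.
  rewrite paddr_eq0 ?sqr_ge0 // !sqrf_eq0 => /andP[/eqP + /eqP r0].
  rewrite r0 mulr0 addr0 => /eqP; rewrite mulf_eq0 gt_eqF //= => /eqP p0.
  by move: detE; rewrite r0 p0; lia.
pose y' : int := s * y - q * z; pose z' : int := p * z - r * y.
pose b' : int := a * p * q + b * (p * s + q * r) + c * r * s.
exists (y' + b' * z'), z'.
have yE : y = p * y' + q * z'.
  by rewrite /y' /z' -[LHS]mul1r -detE; ring.
have zE : z = r * y' + s * z'.
  by rewrite /y' /z' -[LHS]mul1r -detE; ring.
clearbody y' z'; rewrite yE zE.
pose c' : int := a * q ^+ 2 + 2 * b * q * s + c * s ^+ 2.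
have dE : a' * c' - b' ^+ 2 = 1.
  transitivity ((p * s - q * r) ^+ 2 * (a * c - b ^+ 2)); last by rewrite detE d1.
  by rewrite /a' /b' /c'; ring.
transitivity (a' * y' ^+ 2 + 2 * b' * y' * z' + c' * z' ^+ 2).
  by rewrite /a' /b' /c'; ring.
have -> : c' = 1 + b' ^+ 2 by move/eqP: dE; rewrite a'1 mul1r subr_eq => /eqP.
by rewrite a'1; ring.
Qed.

(** If [a <= b], then [3 a^2 <= 4 m], so [27 a^4 <= 48 m^2 <= 64 a] and [27 a^3 <= 64], which
    [a >= 2] excludes. *)
Lemma hermite_descent (a b f m : int) : 2 <= a -> 4 * f ^+ 2 <= a ^+ 2 ->
  a * b - f ^+ 2 = m -> 0 < m -> 3 * m ^+ 2 <= 4 * a -> b < a.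
Proof.
move=> a2 f2 mE m0 m4; rewrite ltNge; apply/negP => le_ab.
have a0 : 0 < a by lia.
have h1 : 3 * a ^+ 2 <= 4 * m by move: (ler_wpM2l (ltW a0) le_ab); lia.
have h2 : (3 * a ^+ 2) ^+ 2 <= (4 * m) ^+ 2.
  by rewrite lerXn2r // nnegrE mulr_ge0 ?sqr_ge0 // ltW.
have h3 : 27 * (a * (a * a)) <= 64.
  rewrite -(ler_pM2l a0).
  have -> : a * (27 * (a * (a * a))) = 3 * (3 * a ^+ 2) ^+ 2 by ring.
  by move: h2; rewrite !exprMn; lia.
move: a2 h3; clear => a2 h3.
have : 4 <= a * a by nia.
by move: h3; nia.
Qed.

(** Hermite's descent on the leading coefficient; the hypotheses are Sylvester's criterion together
    with determinant 1. For [a = 1], completing the square leaves a binary unimodular form. For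
    [a >= 2], a change of basis makes the second diagonal coefficient smaller than [a], and this
    coefficient then takes the first place. *)
Lemma ternary_unimodular_three_squares (a b c d e f : int) :
  0 < a -> 0 < a * b - f ^+ 2 ->
  a * b * c + 2 * d * e * f - a * d ^+ 2 - b * e ^+ 2 - c * f ^+ 2 = 1 ->
  forall x y z : int, exists u v w : int,
    a * x ^+ 2 + b * y ^+ 2 + c * z ^+ 2
      + 2 * d * y * z + 2 * e * x * z + 2 * f * x * y
    = u ^+ 2 + v ^+ 2 + w ^+ 2.
Proof.
have [n] := ubnP `|a|%N; elim: n => // n IHn in a b c d e f * => an a0 m0 det1 x y z.
have ltan (k : int) : 0 < k -> k < a -> (`|k| < n)%N by lia.
have [a1|a_neq1] := eqVneq a 1.
  have [||u [v uvE]] := @binary_unimodular_two_squares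
      (b - f ^+ 2) (d - e * f) (c - e ^+ 2) _ _ y z.
  - by move: m0; rewrite a1 mul1r.
  - by rewrite -[RHS]det1 a1; ring.
  by exists (x + f * y + e * z), u, v; rewrite -[RHS]addrA -uvE a1; ring.
have a2 : 2 <= a by lia.
(* These are the coefficients, in [y] and [z], of [a] times the form minus [(a x + f y + e z)^2];
   the determinant of this binary form is [a]. Reducing it by a change of [y], [z] bounds the minor
   [A1], and shifting [x] then centers [f2] without affecting [A1]. *)
pose A : int := a * b - f ^+ 2; pose B : int := a * d - e * f; pose C : int := a * c - e ^+ 2.
have GE : A * C - B ^+ 2 = a.
  by rewrite -[RHS]mulr1 -det1 /A /B /C; ring.
have [|p [q [r [s [detE le4]]]]] := @binary_form_reduction A B C m0.
  by rewrite GE.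
rewrite GE in le4.
pose f1 : int := f * p + e * r; pose e1 : int := f * q + e * s.
pose b1 : int := b * p ^+ 2 + 2 * d * p * r + c * r ^+ 2.
pose c1 : int := b * q ^+ 2 + 2 * d * q * s + c * s ^+ 2.
pose d1 : int := b * p * q + d * (p * s + q * r) + c * r * s.
have [k kP] := centered_residue f1 a0.
pose f2 : int := f1 + k * a; pose b2 : int := b1 + 2 * k * f1 + k ^+ 2 * a.
pose d2 : int := d1 + k * e1.
pose A1 : int := A * p ^+ 2 + 2 * B * p * r + C * r ^+ 2.
have A1E : a * b2 - f2 ^+ 2 = A1.
  by rewrite /A1 /A /B /C /b2 /f2 /b1 /f1; ring.
have A1_gt0 : 0 < A1.
  have AA1 : A * A1 = (A * p + B * r) ^+ 2 + a * r ^+ 2.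
    by rewrite -[in RHS]GE /A1; ring.
  have A1_ge0 : 0 <= A1.
    by rewrite -(pmulr_rge0 _ m0) AA1 addr_ge0 ?sqr_ge0 // mulr_ge0 ?sqr_ge0 // ltW.
  rewrite lt_neqAle A1_ge0 andbT eq_sym; apply/eqP => A10.
  move: AA1; rewrite A10 mulr0 => /esym/eqP.
  rewrite paddr_eq0 ?sqr_ge0 //; last by rewrite mulr_ge0 ?sqr_ge0 // ltW.
  rewrite sqrf_eq0 [X in _ && X]mulf_eq0 (gt_eqF a0) /= sqrf_eq0.
  move=> /andP[/eqP + /eqP r0]; rewrite r0 mulr0 addr0 => /eqP.
  rewrite mulf_eq0 gt_eqF //= => /eqP p0.
  by move: detE; rewrite r0 p0; lia.
have f2P : 4 * f2 ^+ 2 <= a ^+ 2 by exact: sqr_centered.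
have le4' : 3 * A1 ^+ 2 <= 4 * a by [].
have lt_b2a : b2 < a by exact: (hermite_descent a2 f2P A1E).
have b2_gt0 : 0 < b2.
  by rewrite -(pmulr_rgt0 _ a0) -(subrK (f2 ^+ 2) (a * b2)) A1E ltr_wpDr ?sqr_ge0.
pose y' : int := s * y - q * z; pose z' : int := p * z - r * y.
have yE : y = p * y' + q * z'.
  by rewrite /y' /z' -[LHS]mul1r -detE; ring.
have zE : z = r * y' + s * z'.
  by rewrite /y' /z' -[LHS]mul1r -detE; ring.
(* The first two basis vectors are exchanged here, so that [b2 < a] leads. *)
have [|||u [v [w uvwE]]] :=
    IHn b2 a c1 e1 d2 f2 _ b2_gt0 _ _ y' (x - k * y') z'.
- exact: ltan.
- by rewrite mulrC A1E.
- transitivity ((p * s - q * r) ^+ 2 *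
    (a * b * c + 2 * d * e * f - a * d ^+ 2 - b * e ^+ 2 - c * f ^+ 2)).
    by rewrite /b2 /d2 /f2 /b1 /c1 /d1 /e1 /f1; ring.
  by rewrite detE det1.
exists u, v, w; rewrite -uvwE; clearbody y' z'; rewrite yE zE.
by rewrite /b2 /d2 /f2 /b1 /c1 /d1 /e1 /f1; ring.
Qed.

(* With [P t^2 = -1] mod [n] and [b^2 = -n] mod [P], the integers [s] and [u]
   complete a unimodular positive definite ternary form with last diagonal
   coefficient [n]. *)
Lemma three_squares_of_residues (n P s t b u : int) : 0 < n -> 0 < P ->
  n * s = P * t ^+ 2 + 1 -> P * u = b ^+ 2 * s + 1 ->
  exists x y z : int, n = x ^+ 2 + y ^+ 2 + z ^+ 2.
Proof.
move=> n0 P0 nsE PuE.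
have s0 : 0 < s.
  by rewrite -(pmulr_rgt0 _ n0) nsE ltr_wpDl // mulr_ge0 ?sqr_ge0 ?ltW.
have [|||x [y [z E]]] := @ternary_unimodular_three_squares
    (P * s) u n (t * b) (P * t) (b * s) _ _ _ 0 0 1.
- by rewrite mulr_gt0.
- have -> : P * s * u - (b * s) ^+ 2 = s * (P * u - b ^+ 2 * s) by ring.
  by rewrite PuE addrAC subrr add0r mulr1.
- have -> : P * s * u * n + 2 * (t * b) * (P * t) * (b * s)
      - P * s * (t * b) ^+ 2 - u * (P * t) ^+ 2 - n * (b * s) ^+ 2
    = P * u * (n * s - P * t ^+ 2) - b ^+ 2 * s * (n * s - P * t ^+ 2) by ring.
  by rewrite nsE PuE; ring.
by exists x, y, z; rewrite -E; ring.
Qed.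

(** * The Jacobi symbol *)

(* Gauss's lemma taken as a definition, for composite odd [N] as well. *)
Definition jacobi (N d : nat) : int :=
  if coprime d N then \prod_(i < N./2) (-1) ^+ (N./2 < d * i.+1 %% N)%N else 0.

(** The absolute value of the least absolute residue of [d * i], as in Gauss's lemma; [jacobi] is
    the product of the corresponding signs. *)
Definition abs_residue (N d i : nat) : nat :=
  if (N./2 < d * i %% N)%N then (N - d * i %% N)%N else (d * i %% N)%N.

Lemma dvdn_add_small (N x y : nat) : (0 < x < N)%N -> (y < N)%N ->
  (N %| x + y)%N -> (x + y = N)%N.
Proof.
move=> x0 yN /dvdnP[[|[|k]]]; rewrite ?mulSn; lia.
Qed.

Lemma half_complement (N x y : nat) : odd N -> (x + y = N)%N ->
  (N./2 < y)%N = ~~ (N./2 < x)%N.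
Proof. lia. Qed.

Section AbsResidue.
Local Open Scope nat_scope.
Variables (N d : nat).
Hypotheses (oddN : odd N) (cop : coprime d N).

Lemma modn_coprime_neq0 i : 0 < i <= N./2 -> d * i %% N != 0.
Proof.
move=> /andP[i0 ih]; apply/negP; rewrite -/(N %| d * i) Gauss_dvdr 1?coprime_sym //.
by move=> /(dvdn_leq i0); lia.
Qed.

Lemma abs_residue_bounds i : 0 < i <= N./2 -> 0 < abs_residue N d i <= N./2.
Proof.
move=> ih; have := modn_coprime_neq0 ih; rewrite /abs_residue.
have : d * i %% N < N by rewrite ltn_mod; lia.
by case: ifP; lia.
Qed.

Lemma abs_residue_inj i j : 0 < i <= N./2 -> 0 < j <= N./2 ->
  abs_residue N d i = abs_residue N d j -> i = j.
Proof.
move=> ih jh.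
have di := ltn_pmod (d * i) (odd_gt0 oddN); have dj := ltn_pmod (d * j) (odd_gt0 oddN).
have copN : coprime N d by rewrite coprime_sym.
have same : d * i = d * j %[mod N] -> i = j.
  wlog le_ij : i j {di dj} ih jh / i <= j.
    move=> W; case/orP: (leq_total i j) => le; first exact: W.
    by move=> /esym/W ->.
  move=> /eqP; rewrite eq_sym eqn_mod_dvd; last by rewrite leq_mul2l le_ij orbT.
  rewrite -mulnBr Gauss_dvdr // => dv.
  have [lt_ij|] := ltnP i j; last by lia.
  by move: dv => /dvdn_leq; lia.
have opp : d * i %% N + d * j %% N = N -> False.
  move=> E; have : N %| d * (i + j).
    by rewrite /dvdn mulnDr -modnDm E modnn.
  by rewrite Gauss_dvdr // => /dvdn_leq; lia.
rewrite /abs_residue; case: ifP; case: ifP => bj bi E;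
  by [apply: same; lia | case: opp; lia].
Qed.

(** Absolute residues permute the integers from 1 to [N./2]: if those of [i] and [j] agree, [N]
    divides [d (i - j)] or [d (i + j)], and the latter is impossible as [0 < i + j < N]. *)
Lemma big_abs_residue (R : Type) (idx : R) (op : Monoid.com_law idx) (F : nat -> R) :
  \big[op/idx]_(i < N./2) F (abs_residue N d i.+1) = \big[op/idx]_(i < N./2) F i.+1.
Proof.
have sP (i : 'I_(N./2)) : (abs_residue N d i.+1).-1 < N./2.
  by have := @abs_residue_bounds i.+1 (ltn_ord i); lia.
pose s i := Ordinal (sP i).
have s_inj : injective s.
  move=> i j /(congr1 val) /= E; apply/val_inj/succn_inj.
  apply: abs_residue_inj; [exact: ltn_ord | exact: ltn_ord |].
  have := @abs_residue_bounds i.+1 (ltn_ord i).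
  by have := @abs_residue_bounds j.+1 (ltn_ord j) => /=; lia.
rewrite [RHS](reindex_inj s_inj); apply: eq_bigr => i _; congr F => /=.
by have := @abs_residue_bounds i.+1 (ltn_ord i); lia.
Qed.

End AbsResidue.

Lemma jacobi_mod (N d : nat) : jacobi N (d %% N) = jacobi N d.
Proof.
rewrite /jacobi coprime_modl; case: ifP => // _.
by apply: eq_bigr => i _; rewrite modnMml.
Qed.

Lemma jacobi1 (N : nat) : odd N -> jacobi N 1 = 1.
Proof.
move=> oddN; rewrite /jacobi coprime1n big1 // => i _.
have ih := ltn_ord i; rewrite mul1n modn_small; last by lia.
by rewrite ltnNge ih.
Qed.

(** The sign of [d e i] is the sign of [e i] times the sign of [d j], where [j] is the absolute
    residue of [e i]; as [i] varies, [j] runs over the same range. *)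
Lemma jacobiM (N d e : nat) : odd N -> jacobi N (d * e) = jacobi N d * jacobi N e.
Proof.
move=> oddN; rewrite /jacobi coprimeMl.
case: (boolP (coprime d N)) => copd /=; last by rewrite mul0r.
case: (boolP (coprime e N)) => cope; last by rewrite mulr0.
rewrite -(big_abs_residue oddN cope _ (fun j => (-1) ^+ (N./2 < d * j %% N)%N)).
rewrite -big_split /=; apply: eq_bigr => i _; rewrite -signr_addb; congr (_ ^+ _).
congr nat_of_bool; rewrite /abs_residue -mulnA.
have r0 := modn_coprime_neq0 oddN cope (ltn_ord i : 0 < i.+1 <= _)%N.
have rN := ltn_pmod (e * i.+1) (odd_gt0 oddN).
have := modn_coprime_neq0 oddN copd
  (abs_residue_bounds oddN cope (ltn_ord i : 0 < i.+1 <= _)%N).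
rewrite /abs_residue -[in LHS]modnMmr.
case: ifP => bi s0 /=; last by rewrite addbF.
set r := (e * i.+1 %% N)%N in r0 rN bi s0 *.
have sN := ltn_pmod (d * (N - r)) (odd_gt0 oddN).
have E : ((d * r %% N + d * (N - r) %% N) %% N = 0)%N.
  by rewrite modnDm -mulnDr subnKC 1?ltnW // modnMl.
have tN := ltn_pmod (d * r) (odd_gt0 oddN).
have {}E : (d * (N - r) %% N + d * r %% N = N)%N.
  by apply: dvdn_add_small => //; rewrite ?lt0n ?s0 // /dvdn addnC E.
by rewrite addbT (half_complement oddN E).
Qed.

(** Each of the [N./2] signs is reversed, and [N./2] is odd. *)
Lemma jacobiN (N d : nat) : (N %% 4 = 3)%N -> (d <= N)%N -> jacobi N (N - d) = - jacobi N d.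
Proof.
move=> N3 dN; have oddN : odd N by lia.
have cE : coprime (N - d) N = coprime d N.
  by rewrite -{2}(subnK dN) /coprime gcdnDl gcdnC -{2}(subnK dN) gcdnDr.
rewrite /jacobi cE; case: ifP => cop; last by rewrite oppr0.
have -> : - \prod_(i < N./2) (-1) ^+ (N./2 < d * i.+1 %% N)%N
    = \prod_(i < N./2) ((-1) * (-1) ^+ (N./2 < d * i.+1 %% N)%N) :> int.
  rewrite big_split /= prodr_const card_ord -signr_odd.
  by rewrite (_ : odd N./2) ?expr1 ?mulN1r //; lia.
apply: eq_bigr => i _; rewrite mulN1r -signrN; congr (_ ^+ _).
have r0 := modn_coprime_neq0 oddN cop (ltn_ord i : 0 < i.+1 <= _)%N.
have rN := ltn_pmod (d * i.+1) (odd_gt0 oddN).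
have tN := ltn_pmod ((N - d) * i.+1) (odd_gt0 oddN).
have E : (((N - d) * i.+1 %% N + d * i.+1 %% N) %% N = 0)%N.
  by rewrite modnDm -mulnDl subnK // modnMr.
have {}E : (d * i.+1 %% N + (N - d) * i.+1 %% N = N)%N.
  by apply: dvdn_add_small => //; rewrite ?lt0n ?r0 // /dvdn addnC E.
by rewrite (half_complement oddN E).
Qed.

Lemma jacobi2 (N : nat) : (N %% 8 = 3)%N -> jacobi N 2 = -1.
Proof.
move=> N3; have oddN : odd N by lia.
rewrite /jacobi coprime2n oddN.
transitivity (\prod_(i < N./2) (-1) ^+ (N./2 < 2 * i.+1)%N : int).
  by apply: eq_bigr => i _; rewrite modn_small //; have := ltn_ord i; lia.
have -> : N./2 = ((N %/ 8) * 2 + ((N %/ 8) * 2).+1)%N by lia.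
set k := (N %/ 8 * 2)%N.
rewrite big_split_ord /= [X in X * _]big1 => [|i _]; last first.
  by rewrite (_ : (_ < _)%N = false) //; have := ltn_ord i; lia.
under eq_bigr => i _.
  have -> : (k + k.+1 < 2 * (k + i).+1)%N by have := ltn_ord i; lia.
over.
rewrite mul1r prodr_const card_ord expr1 -signr_odd.
by have -> : odd k.+1 = true by rewrite /k; lia.
Qed.

(** Write [d i = q N + r]. Modulo 2, [i] is [q + r], and [r] is the absolute residue plus the
    exponent of the sign. Over all [i], absolute residues and indices have the same product of
    parity signs, so only the quotients [q] remain. *)
Lemma jacobi_eisenstein (N d : nat) : odd N -> odd d -> coprime d N ->
  jacobi N d = (-1) ^+ (\sum_(i < N./2) (d * i.+1 %/ N))%N.
Proof.
move=> oddN oddd cop; rewrite /jacobi cop.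
rewrite expr_sum.
have E : \prod_(i < N./2) (-1) ^+ abs_residue N d i.+1
    = \prod_(i < N./2) (-1) ^+ i.+1 :> int.
  exact: (big_abs_residue oddN cop _ (fun j => (-1) ^+ j)).
have sq : (\prod_(i < N./2) (-1) ^+ i.+1) * (\prod_(i < N./2) (-1) ^+ i.+1)
    = 1%R :> int.
  by rewrite -big_split big1 // => i _ /=; rewrite -expr2 sqrr_sign.
rewrite -[RHS]mulr1 -[X in _ = _ * X]sq -{1}E -2!big_split /=; apply: eq_bigr => i _.
rewrite -!exprD -[LHS]signr_odd -[RHS]signr_odd; congr (_ ^+ _); congr nat_of_bool.
have := divn_eq (d * i.+1) N.
have rN := ltn_pmod (d * i.+1) (odd_gt0 oddN).
rewrite /abs_residue; set q := (_ %/ N)%N; set r := (_ %% N)%N.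
move=> /(congr1 odd); rewrite oddM oddD oddM oddN oddd andbT /= => odd_i.
rewrite !oddD /= odd_i; case: ifP => bi /=.
  by rewrite oddB 1?ltnW // oddN; case: (odd q); case: (odd r).
by case: (odd q); case: (odd r).
Qed.

Lemma sum_leq_divn (N m k : nat) : (0 < N)%N -> (m %/ N <= k)%N ->
  (\sum_(j < k) (N * j.+1 <= m) = m %/ N)%N.
Proof.
move=> N0; elim: k m => [|k IHk] m; first by rewrite leqn0 big_ord0 => /eqP.
move=> le; rewrite big_ord_recl muln1.
have [lt_mN|le_Nm] := ltnP m N.
  rewrite divn_small // big1 // => j _.
  by apply/eqP; rewrite eqb0 -ltnNge (leq_trans lt_mN) // leq_pmulr.
have E : (m %/ N = (m - N) %/ N + 1)%N by rewrite -{1}(subnK le_Nm) divnDr // divnn N0.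
rewrite E [RHS]addnC; congr (_ + _)%N; rewrite -IHk; last by lia.
by apply: eq_bigr => j _; rewrite lift0; congr nat_of_bool; rewrite mulnS; lia.
Qed.

(** Eisenstein's lattice point count: the two sums of quotients count the points of an [N./2] by
    [d./2] rectangle on either side of the line [N j = d i], which contains none of them by
    coprimality. *)
Lemma jacobi_reciprocity (N d : nat) : odd N -> odd d -> coprime d N ->
  jacobi N d * jacobi d N = (-1) ^+ (N./2 * d./2)%N.
Proof.
move=> oddN oddd cop.
rewrite !jacobi_eisenstein // 1?coprime_sym // -exprD; congr (_ ^+ _).
have N0 := odd_gt0 oddN; have d0 := odd_gt0 oddd.
under eq_bigr => i _.
  rewrite -(@sum_leq_divn N (d * i.+1) d./2) //; last first.
    by rewrite -ltnS ltn_divLR //; have := ltn_ord i; nia.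
  over.
under [X in (_ + X)%N]eq_bigr => i _.
  rewrite -(@sum_leq_divn d (N * i.+1) N./2) //; last first.
    by rewrite -ltnS ltn_divLR //; have := ltn_ord i; nia.
  over.
rewrite [X in (_ + X)%N]exchange_big /= -big_split /=.
rewrite -[in RHS](card_ord N./2) -sum_nat_const.
apply: eq_bigr => i _; rewrite -big_split /= -[in RHS](card_ord d./2) -sum1_card.
apply: eq_bigr => j _.
have : (N * j.+1 != d * i.+1)%N.
  apply/eqP => E; have : (N %| d * i.+1)%N by rewrite -E dvdn_mulr.
  rewrite Gauss_dvdr 1?coprime_sym // => /dvdn_leq.
  by have := ltn_ord i; lia.
by lia.
Qed.

(** * Euler's criterion and square roots modulo a prime *)

Section Euler.
Variables (p : nat).
Hypotheses (pr : prime p) (oddp : odd p).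

Let natrFp_eq0 (k : nat) : (k%:R == 0 :> 'F_p) = (p %| k)%N.
Proof. by rewrite -(dvdn_pcharf (pchar_Fp pr)). Qed.

Lemma euler_criterion (d : nat) : coprime d p ->
  (d%:R : 'F_p) ^+ p./2 = (jacobi p d)%:~R.
Proof.
move=> cop; rewrite /jacobi cop.
pose P : 'F_p := \prod_(i < p./2) i.+1%:R.
have P0 : P != 0.
  apply/prodf_neq0 => i _; rewrite natrFp_eq0; apply/negP => /dvdn_leq.
  by have := ltn_ord i; lia.
have -> : d%:R ^+ p./2 = \prod_(i < p./2) d%:R :> 'F_p.
  by rewrite prodr_const card_ord.
apply: (mulIf P0); rewrite {1}/P -big_split /=.
rewrite /P -(big_abs_residue oddp cop _ (fun j => j%:R : 'F_p)).
rewrite rmorph_prod -big_split /=.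
apply: eq_bigr => i _; rewrite -natrM rmorphXn /= rmorphN1.
have rp := ltn_pmod (d * i.+1) (odd_gt0 oddp).
have E : (d * i.+1)%:R = (d * i.+1 %% p)%:R :> 'F_p.
  by rewrite Fp_nat_mod.
rewrite E /abs_residue; case: ifP => _; last by rewrite mul1r.
by rewrite natrB 1?ltnW // pchar_Fp_0 // sub0r mulN1r opprK.
Qed.

(** The squares of 1, ..., [p./2] are already [p./2] distinct roots of ['X^(p./2) - 1], so there is
    no room for another root. *)
Lemma Fp_square (x : 'F_p) : x ^+ p./2 = 1 -> exists y, x = y ^+ 2.
Proof.
move=> x1; pose rs : seq 'F_p := [seq (i.+1%:R) ^+ 2 | i <- iota 0 p./2].
suff : x \in rs by case/mapP => i _ ->; exists i.+1%:R.
apply/negPn/negP => x_notin.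
have h0 : (0 < p./2)%N by move: (prime_gt1 pr); lia.
pose Q : {poly 'F_p} := 'X^(p./2) - 1.
have Q0 : Q != 0 by rewrite -size_poly_eq0 size_XnsubC.
have : (size (x :: rs) < size Q)%N.
  apply: max_poly_roots => //=.
    rewrite /root !hornerE x1 subrr eqxx /=.
    apply/allP => y /mapP[i]; rewrite mem_iota => /andP[_ ih] ->.
    rewrite /root !hornerE -exprM mul2n.
    have -> : (p./2).*2 = p.-1 by lia.
    suff -> : (i.+1%:R : 'F_p) ^+ p.-1 = 1 by rewrite subrr.
    have i0 : (i.+1%:R : 'F_p) != 0.
      by rewrite natrFp_eq0; apply/negP => /dvdn_leq; lia.
    apply: (mulfI i0); rewrite -exprS prednK ?prime_gt0 // mulr1.
    by rewrite -natrX -[LHS]Fp_nat_mod // fermat_little // Fp_nat_mod.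
  rewrite x_notin map_inj_in_uniq ?iota_uniq // => i j.
  rewrite !mem_iota => /andP[_ ih] /andP[_ jh] /eqP.
  rewrite eqf_sqr -subr_eq0 -[X in _ || X]subr_eq0 opprK -natrD natrFp_eq0.
  case/orP; last by move=> /dvdn_leq; lia.
  wlog le_ji : i j ih jh / (j <= i)%N.
    move=> W; case/orP: (leq_total i j) => le; last exact: W.
    by rewrite -oppr_eq0 opprB => /W ->.
  rewrite -natrB // natrFp_eq0 => dv; have [lt_ji|] := ltnP j i; last by lia.
  by move: dv => /dvdn_leq; lia.
by rewrite size_XnsubC //= size_map size_iota ltnn.
Qed.

(** As [N./2] is odd, reciprocity gives [jacobi p N = (-1)^(p./2)], which cancels the sign of
    [(-N)^(p./2)] in Euler's criterion. *)
Lemma jacobi_neg_residue (N : nat) : (N %% 4 = 3)%N -> coprime p N -> jacobi N p = 1 ->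
  exists b, (p %| b ^ 2 + N)%N.
Proof.
move=> N3 cop j1.
have oddN : odd N by lia.
have := jacobi_reciprocity oddN oddp cop; rewrite j1 mul1r => jE.
have [|y yE] := @Fp_square (- (N%:R)).
  rewrite exprNn euler_criterion 1?coprime_sym // jE rmorphXn /= rmorphN1.
  rewrite -exprD -signr_odd.
  suff -> : odd (p./2 + N./2 * p./2) = false by [].
  by rewrite -[in X in (X + _)%N](mul1n p./2) -mulnDl oddM; lia.
exists (val y); rewrite -natrFp_eq0 natrD natrX.
by rewrite (natr_Zp y) -yE addNr.
Qed.

End Euler.

(** * Nonvanishing of L(1, chi) *)

Lemma abel_bound (R : realFieldType) (B : R) (c b : nat -> R) (K : nat) :
  (forall n, `|\sum_(i < n) c i| <= B) -> (forall i, b i.+1 <= b i) ->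
  (forall i, 0 <= b i) -> `|\sum_(i < K) c i * b i| <= B * b 0%N.
Proof.
move=> cB b_dec b0.
have B0 : 0 <= B by apply: le_trans (cB 0%N); rewrite normr_ge0.
case: K => [|K]; first by rewrite big_ord0 normr0 mulr_ge0.
have -> : \sum_(i < K.+1) c i * b i = (\sum_(i < K.+1) c i) * b K
    + \sum_(i < K) (\sum_(j < i.+1) c j) * (b i - b i.+1).
  elim: K => [|K IHK]; first by rewrite big_ord0 !big_ord1 addr0.
  rewrite big_ord_recr IHK [\sum_(i < K.+2) _]big_ord_recr /=.
  rewrite [\sum_(i < K.+1) _ * (_ - _)]big_ord_recr /=; ring.
apply: le_trans (ler_normD _ _) _; rewrite normrM (ger0_norm (b0 K)).
have -> : B * b 0%N = B * b K + \sum_(i < K) B * (b i - b i.+1).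
  rewrite -mulr_sumr -mulrDr; congr (_ * _).
  elim: K => [|K IHK]; first by rewrite big_ord0 addr0.
  by rewrite big_ord_recr /= IHK; ring.
apply: lerD; first by rewrite ler_wpM2r.
apply: le_trans (ler_norm_sum _ _ _) _; apply: ler_sum => i _.
by rewrite normrM (ger0_norm (_ : 0 <= b i - b i.+1)) ?subr_ge0 // ler_wpM2r ?subr_ge0.
Qed.

(** The inequality of arithmetic and geometric means for 1, [y^2], ..., [y^(2 n)]: pair the extreme
    terms and use induction in steps of two for the inner ones. *)
Lemma geometric_amgm (R : realFieldType) (y : R) (n : nat) : 0 <= y ->
  n.+1%:R * y ^+ n <= \sum_(i < n.+1) (y ^+ 2) ^+ i.
Proof.
move=> y0; have [m] := ubnP n; elim: m => // m IHm in n * => nm.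
case: n nm => [|[|n]] nm; first by rewrite big_ord1 !expr0 mulr1.
  rewrite 2!big_ord_recr big_ord0 /= add0r expr0 !expr1 -subr_ge0.
  by have := sqr_ge0 (1 - y); lra.
rewrite big_ord_recl big_ord_recr /= expr0.
have -> : \sum_(i < n.+1) (y ^+ 2) ^+ bump 0 i = y ^+ 2 * \sum_(i < n.+1) (y ^+ 2) ^+ i.
  by rewrite mulr_sumr; apply: eq_bigr => i _; rewrite -exprS.
have h1 : y ^+ 2 * (n.+1%:R * y ^+ n) <= y ^+ 2 * \sum_(i < n.+1) (y ^+ 2) ^+ i.
  by rewrite ler_wpM2l ?sqr_ge0 // IHm //; lia.
have h2 : 2 * y ^+ n.+2 <= 1 + (y ^+ 2) ^+ n.+2.
  by have := sqr_ge0 (1 - y ^+ n.+2); rewrite exprAC; lra.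
have -> : n.+3%:R * y ^+ n.+2 = y ^+ 2 * (n.+1%:R * y ^+ n) + 2 * y ^+ n.+2.
  by rewrite -[n.+3]addn2 natrD !exprS; ring.
by lra.
Qed.

Lemma bernoulli_le (R : realFieldType) (y : R) (n : nat) : 0 <= y <= 1 ->
  1 - n%:R * (1 - y) <= y ^+ n.
Proof.
move=> /andP[y0 y1]; elim: n => [|n IHn]; first by rewrite mul0r subr0 expr0.
have := ler_wpM2l y0 IHn; rewrite -exprS; apply: le_trans.
rewrite -subr_ge0 -natr1.
have -> : y * (1 - n%:R * (1 - y)) - (1 - (n%:R + 1) * (1 - y))
  = n%:R * (1 - y) ^+ 2 by ring.
by rewrite mulr_ge0 ?ler0n ?sqr_ge0.
Qed.

(** * Monsky's decreasing weights *)

Section Monsky.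
Variables (R : realFieldType) (y : R).
Hypotheses (y0 : 0 <= y) (y1 : y < 1).
Let x := y ^+ 2.
Let s n := \sum_(i < n) x ^+ i.

Let x0 : 0 <= x. Proof. exact: sqr_ge0. Qed.
Let x1 : x < 1. Proof. by rewrite expr_lt1. Qed.

Let s_ge1 n : 1 <= s n.+1.
Proof.
rewrite /s big_ord_recl expr0 lerDl sumr_ge0 // => i _; exact: exprn_ge0.
Qed.

Let s_gt0 n : 0 < s n.+1.
Proof. exact: lt_le_trans (s_ge1 n). Qed.

(** This is [1 / k - (1 - x) x^k / (1 - x^k)] for [k = n + 1]. Taking [x = y^2] provides a square
    root of [x] inside the field, for use in [geometric_amgm]. *)
Definition monsky_weight n : R := n.+1%:R^-1 - x ^+ n.+1 / s n.+1.

Lemma monsky_weight0 : monsky_weight 0 = 1 - x.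
Proof. by rewrite /monsky_weight /s big_ord1 expr0 expr1 invr1 mulr1. Qed.

Lemma monsky_weight_ge0 n : 0 <= monsky_weight n.
Proof.
rewrite subr_ge0 ler_pdivrMr // mulrC ler_pdivlMr ?ltr0n //.
have -> : x ^+ n.+1 * n.+1%:R = \sum_(i < n.+1) x ^+ n.+1.
  by rewrite sumr_const card_ord mulr_natr.
by apply: ler_sum => i _; apply: ler_wiXn2l => //; [exact: ltW | exact: ltnW].
Qed.

(** The difference has the sign of [s_(n+1) s_(n+2) - (n+1) (n+2) x^(n+1)]. By [geometric_amgm] the
    product of the two sums is at least [(n+1) (n+2) y^(2n+1)], and [y^(2n+1) >= x^(n+1)]. *)
Lemma monsky_weight_dec n : monsky_weight n.+1 <= monsky_weight n.
Proof.
have sS : s n.+2 = s n.+1 * x + 1.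
  rewrite /s big_ord_recl expr0 addrC mulr_suml; congr (_ + _).
  by apply: eq_bigr => i _; rewrite mulrC -exprS.
have s1 := s_gt0 n; have s2 := s_gt0 n.+1.
have n1 : 0 < n.+1%:R :> R by rewrite ltr0n.
have n2 : 0 < n.+2%:R :> R by rewrite ltr0n.
have key : n.+1%:R * n.+2%:R * x ^+ n.+1 <= s n.+1 * s n.+2.
  apply: (@le_trans _ _ ((n.+1%:R * y ^+ n) * (n.+2%:R * y ^+ n.+1))); last first.
    by apply: ler_pM; rewrite ?mulr_ge0 ?exprn_ge0 ?ler0n //; exact: geometric_amgm.
  have -> : n.+1%:R * y ^+ n * (n.+2%:R * y ^+ n.+1)
      = n.+1%:R * n.+2%:R * (y ^+ n * y ^+ n.+1) by ring.
  rewrite ler_wpM2l ?mulr_ge0 ?ler0n // /x -exprM -exprD.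
  by apply: ler_wiXn2l => //; [exact: ltW | lia].
have E : monsky_weight n - monsky_weight n.+1
    = (s n.+1 * s n.+2 - n.+1%:R * n.+2%:R * x ^+ n.+1)
      / (n.+1%:R * n.+2%:R * (s n.+1 * s n.+2)).
  transitivity ((n.+2%:R - n.+1%:R) / (n.+1%:R * n.+2%:R)
     - x ^+ n.+1 * (s n.+2 - s n.+1 * x) / (s n.+1 * s n.+2) : R).
    rewrite /monsky_weight [x ^+ n.+2]exprS; field.
    by rewrite -natrD nat1r !pnatr_eq0 !gt_eqF.
  have -> : s n.+2 - s n.+1 * x = 1 by rewrite sS addrAC subrr add0r.
  have -> : n.+2%:R - n.+1%:R = 1 :> R by rewrite -addn1 natrD addrAC subrr add0r.
  by field; rewrite -natrD nat1r !pnatr_eq0 !gt_eqF.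
by rewrite -subr_ge0 E divr_ge0 ?subr_ge0 // !mulr_ge0 ?ler0n // ltW.
Qed.

Lemma multiples_geometric_sum (n K : nat) : (0 < n)%N ->
  (1 - x) * (\sum_(1 <= m < K.+1 | (n %| m)%N) x ^+ m) * s n
  = x ^+ n - x ^+ (n * (K %/ n).+1).
Proof.
move=> n0; have sE : (1 - x) * s n = 1 - x ^+ n.
  by rewrite -[in RHS](expr1n _ n) subrXX /s; congr (_ * _);
     apply: eq_bigr => i _; rewrite expr1n mul1r.
rewrite mulrAC sE; elim: K => [|K IHK].
  by rewrite big_geq // mulr0 div0n muln1 subrr.
rewrite big_mkcond big_nat_recr //= -big_mkcond mulrDr IHK divnS //.
case: ifP => dv; last by rewrite mulr0 addr0.
have -> : K.+1 = (n * (K %/ n).+1)%N.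
  have := divnS K n0; rewrite dv => E; rewrite -(divnK dv) E add1n; lia.
rewrite add1n [(n * _.+2)%N]mulnS exprD; ring.
Qed.

End Monsky.

(** Real Dirichlet characters; being non-principal is expressed by the vanishing of the sum over a
    period. Rational values suffice since L(1, chi) is only approached through its partial sums. *)
Record quadratic_character (M : nat) (chi : nat -> rat) : Prop := {
  qchar_period_gt0 : (0 < M)%N;
  qchar1 : chi 1 = 1;
  qcharD : forall d, chi (d + M)%N = chi d;
  qcharM : forall d e, chi (d * e)%N = chi d * chi e;
  qchar_val : forall d, [|| chi d == 0, chi d == 1 | chi d == -1];
  qchar_coprime : forall d, ~~ coprime d M -> chi d = 0;
  qchar_sum0 : \sum_(d < M) chi d = 0 }.

Section Character.
Variables (M : nat) (chi : nat -> rat) (X : quadratic_character M chi).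
Let M0 := qchar_period_gt0 X.
Let chi1 := qchar1 X.
Let chiD := qcharD X.
Let chiM := qcharM X.
Let chi_val := qchar_val X.
Let chi_sum := qchar_sum0 X.

Lemma qchar_norm d : `|chi d| <= 1.
Proof. by case/or3P: (chi_val d) => /eqP ->; rewrite ?normrN ?normr0 ?normr1. Qed.

Lemma character_sum_bound K : `|\sum_(d < K) chi d.+1| <= M%:R.
Proof.
have shift : \sum_(d < M) chi d.+1 = 0.
  have E n : \sum_(d < n) chi d.+1 + chi 0 = \sum_(d < n) chi d + chi n.
    elim: n => [|n IHn]; first by rewrite !big_ord0.
    by rewrite !big_ord_recr /= addrAC IHn.
  by apply: (addIr (chi 0)); rewrite E -[chi M]/(chi (0 + M)) chiD chi_sum.
have [n] := ubnP K; elim: n => // n IHn in K * => Kn.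
have [ltKM|leMK] := ltnP K M.
  apply: le_trans (ler_norm_sum _ _ _) _.
  apply: (@le_trans _ _ (\sum_(d < K) 1)); first by apply: ler_sum => i _; exact: qchar_norm.
  by rewrite sumr_const card_ord ler_nat ltnW.
have KE : K = (M + (K - M))%N by lia.
rewrite KE big_split_ord /= shift add0r.
under eq_bigr => i _ do rewrite -addnS addnC chiD.
by apply: IHn; lia.
Qed.

Definition divisor_sum (m : nat) : rat := \sum_(d <- divisors m) chi d.

Lemma divisor_sumE (m K : nat) : (0 < m <= K)%N ->
  divisor_sum m = \sum_(1 <= d < K.+1 | (d %| m)%N) chi d.
Proof.
move=> /andP[m0 mK]; rewrite /divisor_sum -[RHS]big_filter; apply: perm_big.
apply: uniq_perm; rewrite ?divisors_uniq ?filter_uniq ?iota_uniq // => d.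
rewrite -dvdn_divisors // mem_filter mem_index_iota; case: (boolP (d %| m)%N) => //= dv.
by rewrite (dvdn_gt0 m0 dv) ltnS (leq_trans (dvdn_leq m0 dv)).
Qed.

Lemma divisor_sum_pfactor (p e n : nat) : prime p -> coprime p n -> (0 < n)%N ->
  divisor_sum (p ^ e * n) = (\sum_(j < e.+1) chi p ^+ j) * divisor_sum n.
Proof.
move=> pr cop n0; rewrite /divisor_sum.
have p0 := prime_gt0 pr.
have chiX j : chi (p ^ j) = chi p ^+ j.
  by elim: j => [|j IHj]; rewrite ?expn0 ?chi1 // expnS chiM IHj exprS.
have -> : \sum_(d <- divisors (p ^ e * n)) chi d
    = \sum_(d <- [seq p ^ j * d | j <- iota 0 e.+1, d <- divisors n]%N) chi d.
  apply: perm_big; apply: uniq_perm; first exact: divisors_uniq.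
    apply: allpairs_uniq; rewrite ?iota_uniq ?divisors_uniq //.
    move=> [i d] [j d'] /allpairsP[[i1 d1] [_ d1n [-> ->]]].
    move=> /allpairsP[[j1 d2] [_ d2n [-> ->]]] /= E.
    rewrite /= -!dvdn_divisors // in d1n d2n.
    have cop1 : coprime p d1 by apply: coprime_dvdr cop.
    have cop2 : coprime p d2 by apply: coprime_dvdr cop.
    have d10 := dvdn_gt0 n0 d1n; have d20 := dvdn_gt0 n0 d2n.
    have ij : i1 = j1.
      move: (congr1 (logn p) E); rewrite !lognM ?expn_gt0 ?p0 // !pfactorK //.
      by rewrite !logn_coprime // !addn0.
    move: E; rewrite ij => /eqP; rewrite eqn_pmul2l ?expn_gt0 ?p0 // => /eqP ->.
    by [].
  move=> d; rewrite -dvdn_divisors ?muln_gt0 ?expn_gt0 ?p0 //.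
  apply/idP/allpairsP => [dv|[[j d1] [+ + ->]]].
    have d0 : (0 < d)%N by apply: dvdn_gt0 dv; rewrite muln_gt0 expn_gt0 p0.
    have [d1 cop1 dE] := pfactor_coprime pr d0.
    exists (logn p d, d1); split; last by rewrite /= mulnC.
      rewrite mem_iota ltnS /=.
      have := dvdn_leq_log p _ dv; rewrite muln_gt0 expn_gt0 p0 n0 => /(_ isT).
      by rewrite lognM ?expn_gt0 ?p0 // pfactorK // (logn_coprime cop) addn0.
    rewrite -dvdn_divisors // -(@Gauss_dvdr _ (p ^ e)) //; last first.
      by rewrite coprime_sym coprimeXl.
    by apply: dvdn_trans dv; rewrite dE dvdn_mulr.
  rewrite mem_iota ltnS /= -dvdn_divisors // => je dn.
  by rewrite dvdn_mul // dvdn_exp2l.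
rewrite big_allpairs_dep -[iota 0 e.+1]/(index_iota 0 e.+1) big_mkord mulr_suml.
apply: eq_bigr => j _; rewrite mulr_sumr; apply: eq_bigr => d _.
by rewrite chiM chiX.
Qed.

Let geom_sign (c : rat) e : [|| c == 0, c == 1 | c == -1] ->
  0 <= \sum_(j < e.+1) c ^+ j /\ (~~ odd e -> 1 <= \sum_(j < e.+1) c ^+ j).
Proof.
case/or3P=> /eqP ->.
- rewrite big_ord_recl expr0 big1 ?addr0 // => i _; exact: expr0n.
- rewrite (eq_bigr (fun=> 1)) => [|i _]; last by rewrite expr1n.
  by rewrite sumr_const card_ord; split=> [|_]; rewrite ?ler0n // ler1n.
- have -> : \sum_(j < e.+1) (-1) ^+ j = (~~ odd e)%:R :> rat.
    elim: e => [|e IHe]; first by rewrite big_ord1.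
    by rewrite big_ord_recr /= IHe -signr_odd /=; case: (odd e).
  by case: (odd e).
Qed.

(** By multiplicativity it is enough to look at the factor of [p^e]: it is 1, [e + 1] or the
    indicator of even [e], for [chi p] equal to 0, 1 or -1. *)
Lemma divisor_sum_ge0 m : (0 < m)%N ->
  0 <= divisor_sum m /\ ((forall p, ~~ odd (logn p m)) -> 1 <= divisor_sum m).
Proof.
have [n] := ubnP m; elim: n => // n IHn in m * => mn m0.
have [m1|m_neq1] := eqVneq m 1%N.
  by rewrite m1 /divisor_sum big_cons big_nil addr0 chi1.
have m_gt1 : (1 < m)%N by lia.
have pr := pdiv_prime m_gt1; set p := pdiv m in pr.
have [k copk mE] := pfactor_coprime pr m0.
have k0 : (0 < k)%N by move: m0; rewrite mE muln_gt0 => /andP[].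
have e0 : (0 < logn p m)%N by rewrite logn_gt0 mem_primes pr m0 pdiv_dvd.
have km : (k < m)%N.
  rewrite [X in (_ < X)%N]mE -{1}[k]muln1 ltn_pmul2l //.
  by rewrite -{1}(expn0 p) ltn_exp2l ?prime_gt1.
have [IH0 IH1] := IHn k (leq_trans km mn) k0.
set e := logn p m in mE e0.
have dE := divisor_sum_pfactor e pr copk k0; rewrite mulnC -mE in dE.
have [g0 g1] := geom_sign e (chi_val p).
rewrite dE; split; first exact: mulr_ge0.
move=> ev; rewrite -[1]mulr1; apply: ler_pM => //; first exact/g1/ev.
apply: IH1 => q; have [->|qp] := eqVneq q p; first by rewrite logn_coprime.
have lE : logn q m = (logn q k + e * logn q p)%N.
  by rewrite {1}mE lognM ?lognX // expn_gt0 prime_gt0.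
have := ev q; rewrite lE.
by rewrite (logn_prime q pr) (negPf qp) muln0 addn0.
Qed.

Lemma divisor_sum_square k : (0 < k)%N -> 1 <= divisor_sum (k ^ 2).
Proof.
move=> k0; have [|_] := @divisor_sum_ge0 (k ^ 2); first by rewrite expn_gt0 k0.
by apply=> p; rewrite lognX oddM.
Qed.

(** Exchanging the sums over [m] and its divisors gives truncated Lambert series. They split into
    the harmonic sum, a sum of [chi] against [monsky_weight], bounded by summation by parts, and
    truncation terms of size at most [x^K] each. *)
Lemma monsky_inequality (y : rat) (K : nat) : 0 <= y -> y < 1 ->
  (1 - y ^+ 2) * \sum_(1 <= m < K.+1) divisor_sum m * (y ^+ 2) ^+ m
  <= \sum_(i < K) chi i.+1 / i.+1%:R + M%:R * (1 - y ^+ 2) + K%:R * (y ^+ 2) ^+ K.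
Proof.
move=> y0 y1; set x := y ^+ 2.
have x0 : 0 <= x by exact: sqr_ge0.
have x1 : x <= 1 by rewrite exprn_ile1 // ltW.
pose s n := \sum_(i < n) x ^+ i.
have s1 n : 1 <= s n.+1.
  by rewrite /s big_ord_recl expr0 lerDl sumr_ge0 // => i _; exact: exprn_ge0.
have -> : (1 - x) * \sum_(1 <= m < K.+1) divisor_sum m * x ^+ m
    = \sum_(i < K) (chi i.+1 / i.+1%:R - chi i.+1 * monsky_weight y i
        - chi i.+1 * (x ^+ (i.+1 * (K %/ i.+1).+1) / s i.+1)).
  transitivity ((1 - x) * \sum_(1 <= n < K.+1)
      chi n * \sum_(1 <= m < K.+1 | (n %| m)%N) x ^+ m).
    congr (_ * _).
    under [RHS]eq_bigr => n _ do rewrite mulr_sumr big_mkcond.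
    rewrite [RHS]exchange_big; apply: eq_big_nat => m mK.
    rewrite (@divisor_sumE m K) // -big_mkcond mulr_suml; exact: eq_bigr.
  rewrite big_add1 /= big_mkord mulr_sumr; apply: eq_bigr => i _.
  rewrite /monsky_weight -/x -/(s _).
  have sn0 : s i.+1 != 0 by rewrite gt_eqF // (lt_le_trans _ (s1 i)).
  have := multiples_geometric_sum y0 y1 K (isT : 0 < i.+1)%N; rewrite -/x -/(s _) => E.
  set T := \sum_(1 <= m < _ | _) _ in E *.
  have {}E : (1 - x) * T = (x ^+ i.+1 - x ^+ (i.+1 * (K %/ i.+1).+1)) / s i.+1.
    by rewrite -E mulfK.
  by rewrite mulrCA E; ring.
rewrite !sumrB -addrA.
have h1 : `|\sum_(i < K) chi i.+1 * monsky_weight y i| <= M%:R * (1 - x).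
  rewrite -[1 - x]monsky_weight0.
  apply: (@abel_bound _ _ (fun i => chi i.+1) (monsky_weight y)).
  - exact: character_sum_bound.
  - by move=> i; exact: monsky_weight_dec.
  - by move=> i; exact: monsky_weight_ge0.
have h2 : `|\sum_(i < K) chi i.+1 * (x ^+ (i.+1 * (K %/ i.+1).+1) / s i.+1)|
    <= K%:R * x ^+ K.
  apply: le_trans (ler_norm_sum _ _ _) _.
  have -> : K%:R * x ^+ K = \sum_(i < K) x ^+ K.
    by rewrite sumr_const card_ord mulr_natl.
  apply: ler_sum => i _; rewrite normrM -[leRHS]mul1r.
  apply: ler_pM => //; first exact: qchar_norm.
  have sgt0 : 0 < s i.+1 by exact: lt_le_trans (s1 i).
  rewrite ger0_norm; last by rewrite divr_ge0 ?exprn_ge0 // ltW.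
  rewrite ler_pdivrMr //.
  apply: (@le_trans _ _ (x ^+ K)); last by rewrite ler_peMr ?exprn_ge0.
  by apply: ler_wiXn2l => //; rewrite mulnC ltnW // ltn_ceil.
by move: h1 h2; rewrite !ler_norml; lra.
Qed.

(** The positivity of L(1, chi). Squares make the divisor sum series exceed [M + 2] when [x] is near
    1; in [monsky_inequality] the errors amount to at most [M + 1] times [1 - x], which leaves
    [delta = 1 - x]. *)
Lemma character_harmonic_lower_bound : exists2 delta : rat, 0 < delta &
  exists K0, forall K, (K0 <= K)%N -> delta <= \sum_(i < K) chi i.+1 / i.+1%:R.
Proof.
(* The first [J] squares contribute at least 1/2 each, hence [M + 2] altogether; [H = 4 J^2] brings
   [y = H / (H + 1)] so close to 1 that [x^m >= 1/2] for [m <= J^2], by Bernoulli. *)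
have [J JE] : exists J, J = (2 * (M + 2))%N by exists (2 * (M + 2))%N.
have [H HE] : exists H, H = (4 * J ^ 2)%N by exists (4 * J ^ 2)%N.
have dge0 m : (0 < m)%N -> 0 <= divisor_sum m by move=> /divisor_sum_ge0[].
pose y : rat := H%:R / H.+1%:R.
have H0 : 0 < H.+1%:R :> rat by rewrite ltr0n.
have y0 : 0 <= y by rewrite divr_ge0 ?ler0n.
have yE : 1 - y = H.+1%:R^-1.
  by rewrite /y -[in X in X / _](addnK 1%N H) addn1 natrB // mulrBl divff ?gt_eqF // mul1r; ring.
have y1 : y < 1 by rewrite -subr_gt0 yE invr_gt0.
pose x := y ^+ 2.
have x0 : 0 <= x by exact: sqr_ge0.
have x1 : x <= y by rewrite /x expr2 ler_piMl // ltW.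
have bern n : 1 - n%:R / H.+1%:R <= y ^+ n by rewrite -yE bernoulli_le // y0 ltW.
have decay n : (H + n)%:R * y ^+ n <= H%:R.
  elim: n => [|n IHn]; first by rewrite addn0 expr0 mulr1.
  apply: le_trans IHn; rewrite exprS mulrA ler_wpM2r ?exprn_ge0 //.
  rewrite /y mulrA ler_pdivrMr // -!natrM ler_nat; nia.
exists (1 - x); first by rewrite subr_gt0 (le_lt_trans x1).
exists (maxn (J ^ 2) (H ^ 2 * H.+1)) => K; rewrite geq_max => /andP[KJ KH].
have := monsky_inequality K y0 y1; rewrite -/x.
(* Split [x^K] as [y^K y^K]: by [decay] the left side is at most [H^2 / (H + K)], which is at most
   [1 / (H + 1) = 1 - y] for [K >= H^2 (H + 1)]. *)
have tail : K%:R * x ^+ K <= 1 - x.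
  apply: (@le_trans _ _ (1 - y)); last by rewrite lerD2l lerN2.
  have K0 : 0 < (H + K)%:R :> rat by rewrite ltr0n; lia.
  have h1 : y ^+ K <= H%:R / (H + K)%:R by rewrite ler_pdivlMr // mulrC.
  have h2 : K%:R * y ^+ K <= H%:R.
    apply: le_trans (decay K); rewrite ler_wpM2r ?exprn_ge0 // ler_nat; lia.
  rewrite /x -exprM mul2n -addnn exprD mulrA yE.
  apply: le_trans (ler_pM _ _ h2 h1) _; rewrite ?mulr_ge0 ?ler0n ?exprn_ge0 //.
  rewrite mulrA ler_pdivrMr // [leRHS]mulrC ler_pdivlMr // -!natrM ler_nat.
  by move: KH; rewrite expnS expn1; lia.
have lower : (M + 2)%:R <= \sum_(1 <= m < K.+1) divisor_sum m * x ^+ m.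
  have half m : (m <= J ^ 2)%N -> 1 / 2 <= x ^+ m.
    move=> mJ; rewrite /x -exprM; apply: le_trans (bern _).
    have h : (2 * m)%:R <= H.+1%:R / 2 :> rat.
      by rewrite ler_pdivlMr ?ltr0n // -natrM ler_nat HE; lia.
    have : (2 * m)%:R / H.+1%:R <= 1 / 2 :> rat.
      by rewrite (ler_pdivrMr _ _ H0); apply: le_trans h _; rewrite mulrAC mul1r.
    by set q := _ / _%:R; lra.
  have sq k : (k <= J)%N -> k%:R / 2 <= \sum_(1 <= m < (k ^ 2).+1) divisor_sum m * x ^+ m.
    elim: k => [|k IHk] kJ; first by rewrite mul0r big_geq.
    rewrite big_nat_recr ?expn_gt0 //= -natr1 mulrDl; apply: lerD; last first.
      have := divisor_sum_square (ltn0Sn k).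
      have : (k.+1 ^ 2 <= J ^ 2)%N by rewrite leq_exp2r.
      move=> /half h1 h2; rewrite -[leLHS]mul1r; apply: ler_pM => //; lra.
    apply: le_trans (IHk (ltnW kJ)) _.
    rewrite [leRHS](@big_cat_nat _ _ _ (k ^ 2).+1) //=; last first.
      by rewrite ltn_exp2r.
    rewrite lerDl big_nat; apply: sumr_ge0 => m /andP[km _].
    by rewrite mulr_ge0 ?exprn_ge0 // dge0 // (leq_ltn_trans _ km).
  have := sq J (leqnn J); have -> : J%:R / 2 = (M + 2)%:R :> rat.
    by rewrite JE natrM mulrAC divff // mul1r.
  move=> h; apply: le_trans h _.
  rewrite [leRHS](@big_cat_nat _ _ _ (J ^ 2).+1) //=.
  rewrite lerDl big_nat; apply: sumr_ge0 => m /andP[km _].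
  by rewrite mulr_ge0 ?exprn_ge0 // dge0 // (leq_ltn_trans _ km).
have xx : 0 <= 1 - x by rewrite subr_ge0 (le_trans x1) // ltW.
have := ler_wpM2l xx lower; rewrite natrD => h1 h2.
by move: h1 h2 tail; rewrite mulrDr [M%:R * _]mulrC; lra.
Qed.

End Character.

(** * Divisor sums in residue classes *)

Lemma count_dvdn_shift (M e Y : nat) : (0 < M)%N ->
  (\sum_(1 <= k < Y.+1) (M %| k + e) + e %/ M = (Y + e) %/ M)%N.
Proof.
move=> M0; elim: Y => [|Y IHY]; first by rewrite big_geq.
by rewrite big_nat_recr //= addnAC IHY addnC addSn divnS.
Qed.

Lemma count_congruence (M a d Y : nat) : (0 < M)%N -> coprime d M ->
  let c := (\sum_(1 <= k < Y.+1) (d * k == a %[mod M]))%N in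
  (M * c <= Y + M)%N /\ (Y <= M * c + M)%N.
Proof.
move=> M0 cop c.
have [d' dd'] : exists d', (d * d' = 1 %[mod M])%N.
  exists (chinese d M 0 1 %/ d)%N.
  rewrite mulnC divnK; first by rewrite (chinese_modr cop).
  by rewrite /dvdn (chinese_modl cop) mod0n.
(* A natural number congruent to [- d' a], where [d'] inverts [d]; the congruence becomes
   divisibility of [k + e]. *)
pose e := (M.-1 * (d' * a))%N.
have cE : c = (\sum_(1 <= k < Y.+1) (M %| k + e))%N.
  apply: eq_bigr => k _; congr nat_of_bool.
  have -> : (M %| k + e)%N = (k == d' * a %[mod M])%N.
    rewrite /dvdn -[X in _ == X](mod0n M) -(eqn_modDr (d' * a)) add0n -addnA.
    by rewrite /e addnC -mulSnr prednK // [(M * _)%N]mulnC modnMDl.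
  apply/eqP/eqP => E.
    by rewrite -[k]mul1n -modnMml -dd' modnMml -mulnA mulnCA -modnMmr E modnMmr.
  by rewrite -modnMmr E modnMmr mulnA -modnMml dd' modnMml mul1n.
have := count_dvdn_shift e Y M0; rewrite -cE => qE.
have := divn_eq (Y + e) M; have := divn_eq e M.
have := ltn_pmod (Y + e) M0; have := ltn_pmod e M0.
clearbody c e; clear -qE; rewrite -qE mulnDl [(M * c)%N]mulnC.
by lia.
Qed.

Lemma big_nat_pred1 (F : nat -> rat) (Q : pred nat) (n b : nat) :
  \sum_(1 <= m < b | Q m && (n == m)) F m = if (0 < n < b)%N && Q n then F n else 0.
Proof.
rewrite -big_filter; case: ifP => [/andP[nb Qn]|nQ].
  rewrite (bigD1_seq n) ?filter_uniq ?iota_uniq ?mem_filter ?Qn ?eqxx ?mem_index_iota //=.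
  rewrite big_filter_cond big_pred0 ?addr0 // => m.
  by rewrite [m == n]eq_sym; case: eqVneq; rewrite ?andbF.
rewrite big_seq big_pred0 // => m; rewrite mem_filter mem_index_iota.
by case: eqVneq => [<-|]; rewrite ?andbF // andbT andbC nQ.
Qed.

Section Hyperbola.
Variables (M : nat) (chi : nat -> rat) (X : quadratic_character M chi).
Variables (a : nat).
Hypothesis (chia : chi a = 1).
Let M0 := qchar_period_gt0 X.

Let chi_mod (m n : nat) : (m = n %[mod M])%N -> chi m = chi n.
Proof.
have per k i : chi (k * M + i)%N = chi i.
  elim: k => [|k IHk]; first by rewrite mul0n.
  by rewrite mulSn -addnA addnC qcharD.
by move=> E; rewrite (divn_eq m M) (divn_eq n M) !per E.
Qed.

(** Pairs with [d k <= D^2] have [d <= D] or [k <= D], the square being counted twice. Since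
    [chi a = 1], the congruence [d k = a] forces [chi d = chi k], so the two halves have equal
    sums. *)
Lemma divisor_sum_hyperbola (D : nat) :
  \sum_(1 <= m < (D ^ 2).+1 | (m == a %[mod M])%N) divisor_sum chi m
  = 2 * (\sum_(1 <= d < D.+1) \sum_(1 <= k < ((D ^ 2) %/ d).+1 | (d * k == a %[mod M])%N) chi d)
    - \sum_(1 <= d < D.+1) \sum_(1 <= k < D.+1 | (d * k == a %[mod M])%N) chi d.
Proof.
set Y := (D ^ 2)%N.
have leDY : (D <= Y)%N by rewrite /Y; nia.
pose P d k := (d * k <= Y)%N && (d * k == a %[mod M])%N.
have totalE : \sum_(1 <= m < Y.+1 | (m == a %[mod M])%N) divisor_sum chi m
    = \sum_(1 <= d < Y.+1) \sum_(1 <= k < Y.+1 | P d k) chi d.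
  transitivity (\sum_(1 <= m < Y.+1 | (m == a %[mod M])%N)
     \sum_(1 <= d < Y.+1) \sum_(1 <= k < Y.+1 | (d * k == m)%N) chi d).
    rewrite big_nat_cond [RHS]big_nat_cond; apply: eq_bigr => m /andP[/andP[m0 mY] _].
    rewrite (@divisor_sumE _ m Y) ?m0 // big_mkcond; apply: eq_big_nat => d /andP[d0 dY].
    case: ifP => dv.
      rewrite (eq_bigl (fun k => predT k && (m %/ d == k)%N)); last first.
        by move=> k /=; rewrite -{1}(divnK dv) [(d * k)%N]mulnC eqn_pmul2r // eq_sym.
      rewrite big_nat_pred1 divn_gt0 // dvdn_leq //= ltnS.
      by rewrite (leq_trans (leq_div _ _)).
    rewrite big_pred0 // => k; apply/eqP => E.
    by move: dv; rewrite -E dvdn_mulr.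
  rewrite exchange_big; apply: eq_big_nat => d /andP[d0 dY].
  rewrite (exchange_big_dep predT) //= [RHS]big_mkcond; apply: eq_big_nat => k /andP[k0 kY].
  rewrite big_nat_pred1 muln_gt0 d0 k0 ltnS; by [].
rewrite totalE (@big_cat_nat _ _ _ D.+1) //=.
have PD d : (0 < d)%N -> \sum_(1 <= k < Y.+1 | P d k) chi d
    = \sum_(1 <= k < (Y %/ d).+1 | (d * k == a %[mod M])%N) chi d.
  move=> d0; rewrite (@big_cat_nat _ _ _ (Y %/ d).+1) //=; last by rewrite ltnS leq_div.
  rewrite [X in _ + X]big_nat_cond [X in _ + X]big_pred0 ?addr0; last first.
    move=> k; apply/negP => /and3P[/andP[kY _]]; rewrite mulnC -leq_divRL // => le.
    by rewrite ltnNge le in kY.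
  rewrite big_nat_cond [RHS]big_nat_cond; apply: eq_bigl => k; rewrite /P.
  case: (boolP (_ <= k < _)%N) => //= /andP[_]; rewrite ltnS leq_divRL // mulnC => ->.
  by [].
have S1E : \sum_(1 <= d < D.+1) \sum_(1 <= k < Y.+1 | P d k) chi d
  = \sum_(1 <= d < D.+1) \sum_(1 <= k < (Y %/ d).+1 | (d * k == a %[mod M])%N) chi d.
  by apply: eq_big_nat => d /andP[d0 _]; exact: PD.
have S2E : \sum_(D.+1 <= d < Y.+1) \sum_(1 <= k < Y.+1 | P d k) chi d
  = \sum_(1 <= k < D.+1) \sum_(D.+1 <= d < Y.+1 | P d k) chi d.
  rewrite (exchange_big_dep predT) //= (@big_cat_nat _ _ _ D.+1) //=.
  rewrite [X in _ + X]big_nat_cond [X in _ + X]big1 ?addr0 // => k /andP[/andP[kD _] _].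
  rewrite big_nat_cond big_pred0 // => d; apply/negP => /and3P[/andP[dD _]].
  by rewrite /Y; nia.
have chi_swap d k : P d k -> chi d = chi k.
  move=> /andP[_ /eqP /chi_mod]; rewrite chia (qcharM X).
  by case/or3P: (qchar_val X d) => /eqP ->; case/or3P: (qchar_val X k) => /eqP ->;
    rewrite ?mul0r ?mulr0 ?mul1r ?mulr1.
have S3E : \sum_(1 <= k < D.+1) \sum_(1 <= d < Y.+1 | P d k) chi d
  = \sum_(1 <= d < D.+1) \sum_(1 <= k < Y.+1 | P d k) chi d.
  apply: eq_bigr => k _; rewrite (eq_bigr (fun=> chi k)); last by move=> d /chi_swap.
  by apply: eq_bigl => d; rewrite /P mulnC.
have S4E : \sum_(1 <= k < D.+1) \sum_(1 <= d < Y.+1 | P d k) chi d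
  = \sum_(1 <= d < D.+1) \sum_(1 <= k < D.+1 | (d * k == a %[mod M])%N) chi d
    + \sum_(1 <= k < D.+1) \sum_(D.+1 <= d < Y.+1 | P d k) chi d.
  rewrite [X in X + _](exchange_big_dep predT) //= -big_split /=.
  apply: eq_big_nat => k /andP[k0 kD]; rewrite (@big_cat_nat _ _ _ D.+1) //=.
  congr (_ + _); rewrite big_nat_cond [RHS]big_nat_cond; apply: eq_bigl => d.
  case: (boolP (_ <= d < _)%N) => //= /andP[_ dD]; rewrite /P.
  by rewrite (_ : (d * k <= Y)%N) // /Y expnS expn1 leq_mul.
rewrite S2E -S1E; move: S4E; rewrite S3E => ->; ring.
Qed.

Let count_error (d Z : nat) :
  `|\sum_(1 <= k < Z.+1 | (d * k == a %[mod M])%N) chi d - chi d * (Z%:R / M%:R)| <= 1.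
Proof.
have M0' : 0 < M%:R :> rat by rewrite ltr0n.
pose c := (\sum_(1 <= k < Z.+1) (d * k == a %[mod M]))%N.
have -> : \sum_(1 <= k < Z.+1 | (d * k == a %[mod M])%N) chi d = chi d * c%:R.
  rewrite /c natr_sum mulr_sumr big_mkcond; apply: eq_bigr => k _.
  by case: ifP; rewrite ?mulr1 ?mulr0.
rewrite -mulrBr normrM.
have [cop|/(qchar_coprime X) ->] := boolP (coprime d M); last by rewrite normr0 mul0r.
have [h1 h2] := count_congruence a Z M0 cop; rewrite -/c in h1 h2.
rewrite -[leRHS]mul1r; apply: ler_pM => //; first exact: (qchar_norm X).
move: h1 h2; rewrite -!(ler_nat rat) !natrD !natrM [M%:R * _]mulrC => h1 h2.
have u1 : c%:R <= Z%:R / M%:R + 1 :> rat.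
  by rewrite -lerBlDr ler_pdivlMr // mulrBl mul1r lerBlDr.
have u2 : Z%:R / M%:R <= c%:R + 1 :> rat by rewrite ler_pdivrMr // mulrDl mul1r.
by rewrite ler_norml; move: u1 u2; set z := _ / _; lra.
Qed.

(** The sum over the residue class up to [D^2] has main term [2 D^2 A / M], with [A >= delta] a
    partial sum of L(1, chi), and total error at most [6 D]. *)
Lemma exists_divisor_sum_neq0 : exists m : nat,
  [/\ (0 < m)%N, (m = a %[mod M])%N & divisor_sum chi m != 0].
Proof.
have M0' : 0 < M%:R :> rat by rewrite ltr0n.
have [delta delta0 [K0 harmP]] := character_harmonic_lower_bound X.
(* This makes [D delta > 3 M], so that the main term exceeds the error [6 D]. *)
have [D DE] : exists D, D = (maxn K0 (Num.truncn (3 * M%:R / delta))).+1 by eexists.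
have D0 : 0 < D%:R :> rat by rewrite ltr0n DE.
have harm : delta <= \sum_(i < D) chi i.+1 / i.+1%:R.
  by apply: harmP; rewrite DE leqW // leq_maxl.
have Dbig : 3 * M%:R < D%:R * delta.
  rewrite -ltr_pdivrMr //; apply: lt_le_trans (truncnS_gt _) _.
  by rewrite ler_nat DE ltnS leq_maxr.
set A := \sum_(i < D) _ in harm.
have S1 : (D ^ 2)%:R / M%:R * A - 2 * D%:R <=
    \sum_(1 <= d < D.+1) \sum_(1 <= k < ((D ^ 2) %/ d).+1 | (d * k == a %[mod M])%N) chi d.
  rewrite lerBlDr -lerBlDl big_add1 big_mkord /= /A mulr_sumr -sumrB.
  have -> : 2 * D%:R = \sum_(i < D) 2 :> rat by rewrite sumr_const card_ord mulr_natr.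
  apply: ler_sum => i _; set S := \sum_(1 <= k < _ | _) _.
  have := count_error i.+1 (D ^ 2 %/ i.+1); rewrite -/S => errS.
  pose q : rat := (D ^ 2)%:R / i.+1%:R - (D ^ 2 %/ i.+1)%:R.
  have i0 : 0 < i.+1%:R :> rat by rewrite ltr0n.
  have q0 : 0 <= q by rewrite subr_ge0 ler_pdivlMr // -natrM ler_nat leq_trunc_div.
  have q1 : q <= 1.
    by rewrite lerBlDr ler_pdivrMr // nat1r -natrM ler_nat ltnW // ltn_ceil.
  have E : (D ^ 2)%:R / M%:R * (chi i.+1 / i.+1%:R)
      = chi i.+1 * ((D ^ 2 %/ i.+1)%:R / M%:R) + chi i.+1 * (q / M%:R).
    by rewrite /q; field; rewrite !gt_eqF // nat1r.
  have qM : `|chi i.+1 * (q / M%:R)| <= 1.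
    rewrite normrM -[leRHS]mulr1; apply: ler_pM => //; first exact: (qchar_norm X).
    rewrite (ger0_norm (divr_ge0 q0 (ltW M0'))) (ler_pdivrMr _ _ M0') mul1r.
    by rewrite (le_trans q1) // ler1n.
  rewrite E; move: errS qM; rewrite !ler_norml.
  move: S (chi _ * _) (chi _ * _) => S u v; lra.
have S3 : \sum_(1 <= d < D.+1) \sum_(1 <= k < D.+1 | (d * k == a %[mod M])%N) chi d
    <= 2 * D%:R.
  have h1 : \sum_(i < D) chi i.+1 * (D%:R / M%:R) <= D%:R.
    rewrite -mulr_suml mulrA ler_pdivrMr // mulrC ler_wpM2l ?ler0n //.
    exact: le_trans (ler_norm _) (character_sum_bound X _).
  have h2 : \sum_(i < D) (1 : rat) = D%:R by rewrite sumr_const card_ord.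
  rewrite big_add1 big_mkord /=.
  apply: (@le_trans _ _ (\sum_(i < D) (chi i.+1 * (D%:R / M%:R) + 1))); last first.
    by rewrite big_split /= h2; move: h1; lra.
  by apply: ler_sum => i _; have := count_error i.+1 D; rewrite ler_norml; lra.
have tot : 0 < \sum_(1 <= m < (D ^ 2).+1 | (m == a %[mod M])%N) divisor_sum chi m.
  rewrite divisor_sum_hyperbola.
  apply: (@lt_le_trans _ _ (2 * ((D ^ 2)%:R / M%:R * A - 2 * D%:R) - 2 * D%:R)); last first.
    by move: S1 S3; lra.
  have -> : 2 * ((D ^ 2)%:R / M%:R * A - 2 * D%:R) - 2 * D%:R
      = 2 * D%:R / M%:R * (D%:R * A - 3 * M%:R).
    by rewrite natrX; field; rewrite gt_eqF.
  apply: mulr_gt0; first exact: divr_gt0 (mulr_gt0 _ D0) M0'.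
  by rewrite subr_gt0 (lt_le_trans Dbig) // ler_wpM2l // ltW.
have [|none] := boolP (has (fun m => (m == a %[mod M])%N && (divisor_sum chi m != 0))
    (index_iota 1 (D ^ 2).+1)).
  case/hasP => m; rewrite mem_index_iota => /andP[m0 _] /andP[/eqP ma fm].
  by exists m.
move: tot; rewrite big_seq_cond big1 ?ltxx // => m /andP[mi ma].
by move/hasPn: none => /(_ m mi); rewrite ma negbK => /eqP.
Qed.

End Hyperbola.

(** Prime powers are stripped one at a time. An even exponent goes into [g]. For an odd exponent,
    [chi p = -1] would annihilate the divisor sum and [chi p = 0] would annihilate [chi m]; hence
    [chi p = 1], and the roots modulo [p] and [q] are glued by the Chinese remainder theorem. *)
Lemma neg_residue_squarefree_kernel (M N : nat) (chi : nat -> rat) (m : nat) :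
  quadratic_character M chi ->
  (forall p, prime p -> chi p = 1 -> exists b, (p %| b ^ 2 + N)%N) ->
  (0 < m)%N -> chi m != 0 -> divisor_sum chi m != 0 ->
  exists q g b, (m = q * g ^ 2)%N /\ (q %| b ^ 2 + N)%N.
Proof.
move=> X res; have [n] := ubnP m; elim: n => // n IHn in m * => mn m0 chim fm.
have [m1|m_neq1] := eqVneq m 1%N.
  by exists 1%N, 1%N, 0%N; rewrite m1 dvd1n.
have m_gt1 : (1 < m)%N by lia.
have pr := pdiv_prime m_gt1; move: (pdiv m) (pdiv_dvd m) pr => p pm pr.
have [k copk] := pfactor_coprime pr m0.
have e0 : (0 < logn p m)%N by rewrite logn_gt0 mem_primes pr m0.
move: (logn p m) e0 => e e0 mE.
have k0 : (0 < k)%N by move: m0; rewrite mE muln_gt0 => /andP[].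
have km : (k < m)%N.
  by rewrite mE -{1}[k]muln1 ltn_pmul2l // -{1}(expn0 p) ltn_exp2l ?prime_gt1.
have chik : chi k != 0 by move: chim; rewrite mE (qcharM X) mulf_eq0 negb_or => /andP[].
have chip : chi p != 0.
  move: chim; rewrite -(divnK pm) (qcharM X) mulf_eq0 negb_or => /andP[] //.
have /andP[geom fk] : (\sum_(j < e.+1) chi p ^+ j != 0) && (divisor_sum chi k != 0).
  by rewrite -negb_or -mulf_eq0 -(divisor_sum_pfactor X) // mulnC -mE.
have [q [g [b [kE qb]]]] := IHn k (leq_trans km mn) k0 chik fk.
have [odde|evene] := boolP (odd e); last first.
  exists q, (g * p ^ e./2)%N, b; split=> //.
  by rewrite mE kE expnMn -expnM muln2 halfK (negPf evene) subn0 mulnA.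
have chip1 : chi p = 1.
  case/or3P: (qchar_val X p) => /eqP // cp; first by rewrite cp eqxx in chip.
  move: geom; rewrite cp.
  suff -> : \sum_(j < e.+1) (-1) ^+ j = (~~ odd e)%:R :> rat by rewrite odde eqxx.
  elim: (e) => [|i IHi]; first by rewrite big_ord1.
  by rewrite big_ord_recr /= IHi -signr_odd /=; case: (odd i).
have [b' pb'] := res p pr chip1.
have copq : coprime p q by apply: coprime_dvdr copk; rewrite kE dvdn_mulr.
exists (p * q)%N, (g * p ^ e./2)%N, (chinese p q b' b); split.
  rewrite mE kE expnMn -expnM muln2 halfK odde.
  have -> : (p ^ e = p * p ^ (e - true))%N by rewrite -expnS subn1 prednK.
  by rewrite [(p * p ^ _)%N]mulnC mulnA [(p * q)%N]mulnC; nia.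
rewrite Gauss_dvd //; apply/andP; split.
  by rewrite /dvdn -modnDml -modnXm (chinese_modl copq) modnXm modnDml.
by rewrite /dvdn -modnDml -modnXm (chinese_modr copq) modnXm modnDml.
Qed.

(** * Sums of three and four squares *)

(** With even arguments sent to 0, every prime of value 1 is odd, as [jacobi_neg_residue]
    demands. *)
Definition odd_jacobi (N d : nat) : rat := if odd d then (jacobi N d)%:~R else 0.

Lemma jacobi_val (N d : nat) : [|| jacobi N d == 0, jacobi N d == 1 | jacobi N d == -1].
Proof.
rewrite /jacobi; case: ifP => // _.
by rewrite -expr_sum -signr_odd; case: (odd _).
Qed.

(** The sum over a period vanishes because replacing [d] by [2 N - d] changes the sign, by
    [jacobiN]. *)
Lemma odd_jacobi_character (N : nat) : (N %% 4 = 3)%N ->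
  quadratic_character (2 * N) (odd_jacobi N).
Proof.
move=> N3; have oddN : odd N by lia.
split.
- by lia.
- by rewrite /odd_jacobi jacobi1.
- move=> d; rewrite /odd_jacobi oddD oddM addbF.
  by rewrite -[jacobi N (d + _)]jacobi_mod addnC modnMDl jacobi_mod.
- move=> d e; rewrite /odd_jacobi oddM jacobiM //.
  by case: (odd d); case: (odd e); rewrite /= ?mulr0 ?mul0r // intrM.
- move=> d; rewrite /odd_jacobi; case: (odd d); last by rewrite eqxx.
  by case/or3P: (jacobi_val N d) => /eqP ->.
- move=> d; rewrite /odd_jacobi coprimeMr coprimen2 /jacobi.
  by case: (odd d) => //= /negPf ->.
have oppE d : (d <= 2 * N)%N -> odd_jacobi N (2 * N - d) = - odd_jacobi N d.
  move=> dN; rewrite /odd_jacobi oddB // oddM /=.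
  case: (odd d); last by rewrite oppr0.
  have dm := ltn_pmod d (odd_gt0 oddN).
  rewrite -[in RHS]jacobi_mod -rmorphN /= -jacobiN 1?ltnW //.
  congr (_%:~R); rewrite -jacobi_mod -[RHS]jacobi_mod; congr jacobi.
  apply/eqP; rewrite -(eqn_modDr d) subnK // -[X in _ == X]modnDmr.
  by rewrite subnK 1?ltnW // modnMl modnn.
have -> : (2 * N = (2 * N).-1.+1)%N by lia.
rewrite big_ord_recl [X in X + _](_ : _ = 0) // add0r.
set S := \sum_(i < _) _.
suff : S = - S by move=> h; lra.
rewrite {1}/S (reindex_inj rev_ord_inj) /S -sumrN /=.
apply: eq_bigr => i _; rewrite /bump /= -oppE; last by have := ltn_ord i; lia.
by congr odd_jacobi; have := ltn_ord i; lia.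
Qed.

Theorem three_squares_mod8 (N : nat) : (N %% 8 = 3)%N ->
  exists x y z : int, N%:Z = x ^+ 2 + y ^+ 2 + z ^+ 2.
Proof.
move=> N3; have oddN : odd N by lia.
have N4 : (N %% 4 = 3)%N by lia.
have X := odd_jacobi_character N4.
have jh : jacobi N N./2 = 1.
  have : jacobi N (2 * N./2) = -1.
    have -> : (2 * N./2 = N - 1)%N by lia.
    by rewrite jacobiN ?jacobi1 //; lia.
  by rewrite jacobiM // jacobi2 // mulN1r => /oppr_inj.
have chih : odd_jacobi N N./2 = 1.
  by rewrite /odd_jacobi jh (_ : odd N./2) //; lia.
have [m [m0 mh fm]] := exists_divisor_sum_neq0 X chih.
have mE0 : (m = m %/ (2 * N) * (2 * N) + N./2)%N.
  by rewrite [LHS](divn_eq m (2 * N)) mh [(N./2 %% _)%N]modn_small //; lia.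
(* Once [m = q g^2], this is the first equation of [three_squares_of_residues] with [P = 2 q] and
   [t = g]. *)
have mE : (2 * m + 1 = (m %/ (2 * N) * 4 + 1) * N)%N.
  by move: mE0; move: (m %/ _)%N => k; rewrite mulnDl mul1n; lia.
have oddm : odd m by rewrite mE0 oddD !oddM andbF /=; clear -N3; lia.
have chim : odd_jacobi N m != 0.
  rewrite /odd_jacobi oddm intr_eq0 -jacobi_mod.
  have -> : (m %% N = N./2)%N.
    by rewrite -(modn_dvdm m (dvdn_mull 2 (dvdnn N))) mh modn_dvdm ?dvdn_mull // modn_small; lia.
  by rewrite jh.
have res p : prime p -> odd_jacobi N p = 1 -> exists b, (p %| b ^ 2 + N)%N.
  move=> pr; rewrite /odd_jacobi; case: ifP => // oddp /eqP.
  rewrite -[1]/(1%:~R) eqr_int => /eqP jp; apply: jacobi_neg_residue => //.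
  by move: jp; rewrite /jacobi; case: ifP.
have [q [g [b [qE qb]]]] := neg_residue_squarefree_kernel X res m0 chim fm.
have oddq : odd q by move: oddm; rewrite qE oddM => /andP[].
(* An odd root makes [c^2 + N] even, hence divisible by [2 q] and not only by [q]. *)
have [c [oddc qc]] : exists c, odd c /\ (q %| c ^ 2 + N)%N.
  case: (boolP (odd b)) => oddb; first by exists b.
  exists (b + q)%N; split; first by rewrite oddD oddq (negPf oddb).
  have -> : ((b + q) ^ 2 + N = b ^ 2 + N + q * (2 * b + q))%N.
    by rewrite sqrnD; lia.
  by rewrite dvdn_add // dvdn_mulr.
have /dvdnP[w wE] : (2 * q %| c ^ 2 + N)%N.
  by rewrite Gauss_dvd ?coprime2n // qc andbT dvdn2 oddD oddX oddc oddN.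
move: (m %/ (2 * N) * 4 + 1)%N mE => s mE; rewrite qE in mE.
have N0 := odd_gt0 oddN; have q0 := odd_gt0 oddq.
clear -N0 q0 mE wE.
(* The last witness comes from [2 q w s = (c^2 + N) s] and [N s = 2 q g^2 + 1]: their combination is
   [2 q (w s - g^2) = c^2 s + 1]. *)
apply: (@three_squares_of_residues N (2 * q)%N s g c (w%:Z * s%:Z - g%:Z ^+ 2)).
- by rewrite ltz_nat.
- by rewrite ltz_nat muln_gt0.
- have h : (2 * (q * g ^ 2) + 1)%N = (s * N)%N :> int by rewrite mE.
  by move: h; rewrite expr2 expnS expn1; lia.
- have h1 : (2 * (q * g ^ 2) + 1)%N = (s * N)%N :> int by rewrite mE.
  have h2 : (c ^ 2 + N)%N = (w * (2 * q))%N :> int by rewrite wE.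
  move: h1 h2; rewrite !expnS !expn0 !muln1 !(PoszD, PoszM) !expr2 => h1 h2.
  have h3 : (c%:Z * c%:Z + N%:Z) * s%:Z = w%:Z * (2 * q%:Z) * s%:Z by rewrite h2.
  by move: h1 h3; lia.
Qed.

Lemma int_sqr_mod4 (x : int) :
  exists k : int, (x ^+ 2 = 4 * k /\ (x %% 2)%Z = 0) \/ (x ^+ 2 = 4 * k + 1 /\ (x %% 2)%Z = 1).
Proof.
have := divz_eq x 2; set k := (x %/ 2)%Z => xE.
have [x0|x1] : (x %% 2)%Z = 0 \/ (x %% 2)%Z = 1 by lia.
  by exists (k ^+ 2); left; split=> //; rewrite {1}xE x0; ring.
by exists (k ^+ 2 + k); right; split=> //; rewrite {1}xE x1; ring.
Qed.

Lemma three_squares_odd (x y z t : int) : x ^+ 2 + y ^+ 2 + z ^+ 2 = 4 * t + 3 ->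
  [/\ (x %% 2)%Z = 1, (y %% 2)%Z = 1 & (z %% 2)%Z = 1].
Proof.
have [kx hx] := int_sqr_mod4 x; have [ky hy] := int_sqr_mod4 y.
have [kz hz] := int_sqr_mod4 z.
case: hx => -[-> ->]; case: hy => -[-> ->]; case: hz => -[-> ->] // E; exfalso; lia.
Qed.

(** Write [4 S - n^2], which is 3 mod 8, as [x^2 + y^2 + z^2]; all three are odd, and a sign of [z]
    makes 4 divide [n + x + y + z]. The solution consists of the quarters of [n + x + y + z] and its
    variants with two minus signs, nonnegative because [(x + y + z)^2 <= 3 (4 S - n^2) <= n^2],
    likewise with signs. *)
Lemma cauchy_four_squares (n S : nat) : odd n -> odd S -> (n ^ 2 < 4 * S)%N ->
  (3 * S <= n ^ 2)%N -> exists a b c d : nat,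
  (a + b + c + d = n)%N /\ (a ^ 2 + b ^ 2 + c ^ 2 + d ^ 2 = S)%N.
Proof.
move=> oddn oddS n4 S3.
have n2 : (n ^ 2 %% 8 = 1)%N.
  have -> : n = (2 * n./2 + 1)%N by lia.
  have : (2 %| n./2 * n./2.+1)%N by rewrite dvdn2 oddM /=; case: (odd _).
  by move=> /dvdnP[k]; rewrite expnS expn1; nia.
have [|x [y [z xyz]]] := @three_squares_mod8 (4 * S - n ^ 2); first by lia.
have xyzE : x ^+ 2 + y ^+ 2 + z ^+ 2 = 4 * S%:Z - n%:Z ^+ 2.
  by rewrite -xyz -subzn 1?ltnW // PoszM expnS expn1 PoszM expr2.
have [k kE] : exists k : nat, (n ^ 2 = 4 * k + 1)%N by exists (n ^ 2 %/ 4)%N; lia.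
have [xo yo zo] : [/\ (x %% 2)%Z = 1, (y %% 2)%Z = 1 & (z %% 2)%Z = 1].
  by apply: (@three_squares_odd _ _ _ (S%:Z - k%:Z - 1)); rewrite -xyz kE; clear -n4 kE; lia.
wlog div4 : z xyz xyzE zo / ((n%:Z + x + y + z) %% 4)%Z = 0.
  move=> W; have [h|h] : ((n%:Z + x + y + z) %% 4)%Z = 0 \/
      ((n%:Z + x + y - z) %% 4)%Z = 0 by clear -oddn xo yo zo; lia.
    exact: (W z).
  by apply: (W (- z)); rewrite ?sqrrN //; clear -zo; lia.
have bound (e1 e2 : int) : e1 ^+ 2 = 1 -> e2 ^+ 2 = 1 -> 0 <= n%:Z + e1 * x + e2 * y + e1 * e2 * z.
  move=> h1 h2; set w := e1 * x + e2 * y + e1 * e2 * z.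
  have -> : n%:Z + e1 * x + e2 * y + e1 * e2 * z = n%:Z + w by rewrite /w; ring.
  suff : `|w| <= n%:Z by rewrite ler_norml => /andP[]; clear; lia.
  rewrite -(@ler_pXn2r _ 2) ?nnegrE ?normr_ge0 // real_normK ?num_real //.
  have : w ^+ 2 <= 3 * (x ^+ 2 + y ^+ 2 + z ^+ 2).
    rewrite -subr_ge0.
    have -> : 3 * (x ^+ 2 + y ^+ 2 + z ^+ 2) - w ^+ 2 =
      (e1 * x - e2 * y) ^+ 2 + (e1 * x - e1 * e2 * z) ^+ 2 + (e2 * y - e1 * e2 * z) ^+ 2
      + 3 * (1 - e1 ^+ 2) * x ^+ 2 + 3 * (1 - e2 ^+ 2) * y ^+ 2
      + 3 * (1 - e1 ^+ 2 * e2 ^+ 2) * z ^+ 2 by rewrite /w; ring.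
    by rewrite h1 h2 mulr1 subrr mulr0 !mul0r !addr0 !addr_ge0 ?sqr_ge0.
  have : 3 * S%:Z <= n%:Z ^+ 2 by move: S3; rewrite expr2 expnS expn1; lia.
  by rewrite xyzE; clear; lia.
have b1 := bound 1 1 erefl erefl; have b2 := bound 1 (-1) erefl erefl.
have b3 := bound (-1) 1 erefl erefl; have b4 := bound (-1) (-1) erefl erefl.
clear -xyzE xo yo zo div4 b1 b2 b3 b4.
have [a aE] : exists a : nat, 4 * a%:Z = n%:Z + x + y + z.
  by exists `|((n%:Z + x + y + z) %/ 4)%Z|%N; lia.
have [b bE] : exists b : nat, 4 * b%:Z = n%:Z + x - y - z.
  by exists `|((n%:Z + x - y - z) %/ 4)%Z|%N; lia.
have [c cE] : exists c : nat, 4 * c%:Z = n%:Z - x + y - z.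
  by exists `|((n%:Z - x + y - z) %/ 4)%Z|%N; lia.
have [d dE] : exists d : nat, 4 * d%:Z = n%:Z - x - y + z.
  by exists `|((n%:Z - x - y + z) %/ 4)%Z|%N; lia.
exists a, b, c, d; split; first by clear -aE bE cE dE; lia.
have : 16 * (a%:Z ^+ 2 + b%:Z ^+ 2 + c%:Z ^+ 2 + d%:Z ^+ 2) = 16 * S%:Z.
  transitivity ((4 * a%:Z) ^+ 2 + (4 * b%:Z) ^+ 2 + (4 * c%:Z) ^+ 2 + (4 * d%:Z) ^+ 2).
    by ring.
  rewrite aE bE cE dE.
  transitivity (4 * (n%:Z ^+ 2 + (x ^+ 2 + y ^+ 2 + z ^+ 2))); first by ring.
  by rewrite xyzE; ring.
by rewrite !expr2 !expnS !expn0; clear; lia.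
Qed.

(** * Edge counts of disjoint unions of cliques *)

Local Open Scope classical_set_scope.

Section CliqueCounts.
Local Open Scope nat_scope.

Lemma double_bin2 (k : nat) : 2 * 'C(k, 2) + k = k ^ 2.
Proof. by elim: k => // k IHk; rewrite binS bin1 -[k.+1 in RHS]addn1 sqrnD -IHk; lia. Qed.

Lemma double_sum_bin2 (r : nat) (k : 'I_r -> nat) :
  2 * (\sum_(i < r) 'C(k i, 2)) + \sum_(i < r) k i = \sum_(i < r) k i ^ 2.
Proof.
by rewrite big_distrr -big_split; apply: eq_bigr => i _; exact: double_bin2.
Qed.

Lemma sum_sqr_lower (r : nat) (k : 'I_r -> nat) :
  (\sum_(i < r) k i) ^ 2 <= r * \sum_(i < r) k i ^ 2.
Proof.
rewrite -(leq_pmul2l (isT : 0 < 2)).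
have -> : 2 * (\sum_(i < r) k i) ^ 2 = \sum_(i < r) \sum_(j < r) 2 * (k i * k j).
  rewrite expnS expn1 big_distrlr big_distrr; apply: eq_bigr => i _.
  by rewrite big_distrr.
have -> : 2 * (r * \sum_(i < r) k i ^ 2) = \sum_(i < r) \sum_(j < r) (k i ^ 2 + k j ^ 2).
  under [RHS]eq_bigr => i _ do rewrite big_split /= sum_nat_const card_ord.
  by rewrite big_split /= sum_nat_const card_ord -big_distrr /= mul2n addnn.
by apply: leq_sum => i _; apply: leq_sum => j _; exact: nat_Cauchy.
Qed.

Lemma sum_sqr_upper (r : nat) (k : 'I_r -> nat) :
  \sum_(i < r) k i ^ 2 <= (\sum_(i < r) k i) ^ 2.
Proof.
rewrite expnS expn1 big_distrl; apply: leq_sum => i _ /=.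
by rewrite expnS expn1 leq_mul2l (bigD1 i) //= leq_addr orbT.
Qed.

Lemma clique_edge_count_bounds (n r m : nat) : cliqueEdgeCounts n r m ->
  n ^ 2 <= r * (2 * m + n) /\ 2 * m + n <= n ^ 2.
Proof.
case=> k kn mE.
have E : 2 * m + n = \sum_(i < r) k i ^ 2 by rewrite -double_sum_bin2 kn mE.
by rewrite E; split; rewrite -kn; [exact: sum_sqr_lower | exact: sum_sqr_upper].
Qed.

Lemma clique_edge_count_seq (n m : nat) (s : seq nat) :
  \sum_(x <- s) x = n -> \sum_(x <- s) x ^ 2 = 2 * m + n ->
  cliqueEdgeCounts n (size s) m.
Proof.
move=> sn s2.
have e1 : \sum_(i < size s) nth 0 s i = n by rewrite -sn (big_nth 0) big_mkord.
have e2 : \sum_(i < size s) nth 0 s i ^ 2 = 2 * m + n.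
  by rewrite -s2 (big_nth 0) big_mkord.
exists (fun i => nth 0 s i) => //.
by have := double_sum_bin2 (fun i : 'I_(size s) => nth 0 s i); rewrite e1 e2; lia.
Qed.

(* All but five of the cliques get [y] vertices and one gets
   [n - 1 - (r - 1) y]; the last four, with [4 y + 1] vertices in total, are
   supplied by Cauchy's lemma.  The least [y] leaving them enough edges leaves
   them not too many, as one step of [y] changes the count by only [O(n)]. *)
Lemma clique_edge_count_interval (n r m z : nat) : 5 <= r ->
  n ^ 2 + r ^ 3 + r <= r * (2 * m + n) ->
  2 * m + n < (n - 1 - r.-1 * z) ^ 2 ->
  6 * r.-1 * n + 3 * r.-1 ^ 2 <= 4 * z ^ 2 ->
  cliqueEdgeCounts n r m.
Proof.
case: r => // p; rewrite /= ltnS => p4 lo up zP.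
have [S SE0] : exists S, S = 2 * m + n by eexists.
rewrite -SE0 in lo up.
pose g y := p * y ^ 2 + (n - 1 - p * y) ^ 2.
(* The first condition says that the sum of squares [S'] left to the last four cliques is at least
   [4 y^2 + 2 y + 1], that is [(4 y + 1)^2 < 4 S']. *)
pose ok y := (g y + 2 * y + 1 <= S) && (p * y <= n - 1).
have n0 : 0 < n by move: up; case: (n) => //; rewrite ltn0.
have ex_ok : exists y, ok y.
  (* Nearly equal sizes: the leftover [w < r] accounts for the slack [r^3 + r] in [lo]. *)
  exists ((n - 1) %/ p.+1).
  have := divn_eq (n - 1) p.+1; have := ltn_pmod (n - 1) (ltn0Sn p).
  move: ((n - 1) %/ p.+1) ((n - 1) %% p.+1) => y w wp nE.
  have nE' : n = p * y + y + w + 1 by move: nE; rewrite mulnS mulnC; clear -n0; lia.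
  have TE : n - 1 - p * y = y + w by rewrite nE'; clear; lia.
  rewrite /ok /g TE; apply/andP; split; last by rewrite nE'; clear; lia.
  rewrite -(leq_pmul2l (ltn0Sn p)); apply: leq_trans lo.
  have : p.+1 * w ^ 2 <= p.+1 ^ 3 by rewrite (expnS _ 2) leq_mul2l leq_exp2r // ltnW.
  by rewrite nE'; clear; lia.
have [y /andP[yS yn] ymin] := ex_minnP ex_ok.
have [T TE] : exists T, T = n - 1 - p * y by eexists.
(* For [y <= z] the single clique of size [T] alone would exceed [S], by [up]. This makes [y] large
   enough for the upper bound on [S'] below. *)
have lt_zy : z < y.
  rewrite ltnNge; apply/negP => le_yz.
  have : (n - 1 - p * z) ^ 2 <= T ^ 2.
    by rewrite TE leq_exp2r // leq_sub2l // leq_mul2l le_yz orbT.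
  by move: yS up; rewrite /g -TE; clear; lia.
have SltT : S < p * y.-1 ^ 2 + (T + p) ^ 2 + 2 * y.-1 + 1.
  have : ~~ ok y.-1 by apply/negP => /ymin; clear -lt_zy; lia.
  have T1E : n - 1 - p * y.-1 = T + p.
    rewrite TE; move: yn lt_zy; case: (y) => // y'; rewrite /= mulnS; clear; lia.
  rewrite /ok /g T1E.
  have -> : p * y.-1 <= n - 1 by apply: leq_trans yn; rewrite leq_mul2l leq_pred orbT.
  by rewrite andbT -ltnNge.
have [q pE] : exists q, p = q + 4 by exists (p - 4); rewrite subnK.
have nE : n = q * y + T + (4 * y + 1).
  by move: yn; rewrite TE pE mulnDl; clear -n0; lia.
have gE : g y = q * y ^ 2 + 4 * y ^ 2 + T ^ 2 by rewrite /g -TE pE mulnDl.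
have [S' SE] : exists S', S = S' + q * y ^ 2 + T ^ 2.
  by exists (S - q * y ^ 2 - T ^ 2); move: yS; rewrite gE; clear; lia.
have [||||a [b [c [d [abcd abcd2]]]]] := @cauchy_four_squares (4 * y + 1) S'.
- by rewrite addn1 /= oddM.
- have : odd S = odd n by rewrite SE0 oddD oddM.
  rewrite SE nE !oddD !oddM ?oddX /=.
  by case: (odd S'); case: (odd q); case: (odd y); case: (odd T).
- by move: yS; rewrite gE SE; clear; lia.
(* Failure of [ok] at [y - 1] bounds [S'] by about [4 y^2 + 2 p T + p^2 + 2 y]; by [zP], the terms
   [6 p T + 3 p^2] in [3 S'] are at most [4 y^2], so [3 S' <= (4 y + 1)^2]. *)
- have Tn : p * T <= p * n by rewrite leq_mul2l nE; clear; lia.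
  have z2 : z ^ 2 <= y ^ 2 by rewrite leq_exp2r // ltnW.
  have y2 : p * y.-1 ^ 2 <= q * y ^ 2 + 4 * y ^ 2.
    by rewrite -mulnDl -pE leq_mul2l leq_exp2r // leq_pred orbT.
  have T2 : (T + p) ^ 2 = T ^ 2 + 2 * (p * T) + p ^ 2 by rewrite sqrnD; clear; lia.
  move: SltT zP Tn z2 y2 lt_zy; rewrite T2 SE -mulnA sqrnD; clear.
  move: (p * y.-1 ^ 2) (p * T) (p * n) (p ^ 2) (T ^ 2) (q * y ^ 2) (z ^ 2).
  by lia.
have -> : p.+1 = size (nseq q y ++ [:: T; a; b; c; d]).
  by rewrite size_cat size_nseq /= pE; clear; lia.
apply: clique_edge_count_seq; rewrite big_cat /= big_nseq !big_cons big_nil iter_addn_0.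
  by rewrite [RHS]nE -abcd; clear; lia.
by rewrite -SE0 SE -abcd2; clear; lia.
Qed.

End CliqueCounts.

(** * Counting and asymptotics *)

Lemma numCliqueEdgeCounts_le (n r a b : nat) :
  (forall m, cliqueEdgeCounts n r m -> (a <= m < b)%N) ->
  (numCliqueEdgeCounts n r <= b - a)%N.
Proof.
move=> ab; have := card_fseq (index_iota a b); rewrite undup_id ?iota_uniq // size_iota => <-.
apply/fsubset_leq_card/fsubsetP => m.
rewrite in_fset_set; last exact: finite_cliqueEdgeCounts.
by rewrite inE => /ab mab; rewrite inE mem_index_iota.
Qed.

Lemma numCliqueEdgeCounts_ge (n r a b : nat) :
  (forall m, (a <= m < b)%N -> cliqueEdgeCounts n r m) ->
  (b - a <= numCliqueEdgeCounts n r)%N.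
Proof.
move=> ab; have := card_fseq (index_iota a b); rewrite undup_id ?iota_uniq // size_iota => <-.
apply/fsubset_leq_card/fsubsetP => m; rewrite inE mem_index_iota => /ab mC.
by rewrite in_fset_set ?inE //; exact: finite_cliqueEdgeCounts.
Qed.

Lemma natr_divn_bounds (R : realFieldType) (m d : nat) : (0 < d)%N ->
  m%:R / d%:R - 1 <= ((m %/ d)%:R : R) <= m%:R / d%:R.
Proof.
move=> d0; have d0' : 0 < d%:R :> R by rewrite ltr0n.
rewrite lerBlDr ler_pdivrMr // ler_pdivlMr // natr1 -!natrM !ler_nat.
by rewrite leq_trunc_div andbT ltnW // ltn_ceil.
Qed.

Lemma numCliqueEdgeCounts_upper (R : realFieldType) (n r : nat) : (0 < r)%N ->
  (numCliqueEdgeCounts n r)%:R <= n%:R ^+ 2 / 2 - n%:R ^+ 2 / (2 * r%:R) + 3 :> R.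
Proof.
move=> r0; pose a := ((n ^ 2 %/ r - n) %/ 2)%N; pose b := ((n ^ 2 - n) %/ 2).+1%N.
have le_ba : (numCliqueEdgeCounts n r <= b - a)%N.
  apply: numCliqueEdgeCounts_le => m /clique_edge_count_bounds[lo up].
  have : (n ^ 2 %/ r <= 2 * m + n)%N by rewrite -(mulKn (2 * m + n) r0) leq_div2r.
  by rewrite /a /b; lia.
have ab : (a <= b)%N.
  rewrite /a /b leqW // leq_div2r // leq_sub2r //; exact: leq_div.
apply: (@le_trans _ _ (b - a)%:R); first by rewrite ler_nat.
rewrite natrB //.
have r0' : 0 < r%:R :> R by rewrite ltr0n.
have hb : b%:R <= (n%:R ^+ 2 - n%:R) / 2 + 1 :> R.
  rewrite /b -natr1 lerD2r -natrX.
  have /andP[_ h] := natr_divn_bounds R (n ^ 2 - n) (isT : 0 < 2)%N.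
  by apply: le_trans h _; rewrite natrB //; nia.
have ha : (n%:R ^+ 2 / r%:R - 1 - n%:R) / 2 - 1 <= a%:R :> R.
  have /andP[h1 _] := natr_divn_bounds R (n ^ 2 %/ r - n) (isT : 0 < 2)%N.
  apply: le_trans _ h1; rewrite lerD2r ler_pM2r ?invr_gt0 ?ltr0n //.
  have /andP[h2 _] := natr_divn_bounds R (n ^ 2) r0.
  rewrite natrX in h2; have : (n ^ 2 %/ r)%:R <= (n ^ 2 %/ r - n)%:R + n%:R :> R.
    by rewrite -natrD ler_nat; lia.
  by move: h2; lra.
have -> : n%:R ^+ 2 / (2 * r%:R) = n%:R ^+ 2 / r%:R / 2 :> R.
  by field; rewrite gt_eqF.
by move: ha hb; lra.
Qed.

(** The parameter [z] stays free: the hypothesis asks for order [sqrt n], while the upper end of the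
    attained interval loses about [r z n], so any such [z = o(n)] serves. *)
Lemma numCliqueEdgeCounts_lower (R : realFieldType) (n r z : nat) : (5 <= r)%N ->
  (6 * r.-1 * n + 3 * r.-1 ^ 2 <= 4 * z ^ 2)%N ->
  n%:R ^+ 2 / 2 - n%:R ^+ 2 / (2 * r%:R) - 2 * n%:R - r%:R * z%:R * n%:R
    - (r ^ 3 + r + 3)%:R <= (numCliqueEdgeCounts n r)%:R :> R.
Proof.
move=> r5 zP.
have [t tE] : exists t, t = ((n - 1 - r.-1 * z) ^ 2)%N by eexists.
have [a aE] : exists a, a = (n ^ 2 %/ (2 * r) + (r ^ 3 + r + 1))%N by eexists.
have [b bE] : exists b, b = ((t - n) %/ 2)%N by eexists.
have rp : (0 < r)%N := ltn_trans (isT : 0 < 4)%N r5.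
have r0 : (0 < 2 * r)%N by rewrite muln_gt0 rp.
have r0' : 0 < r%:R :> R by rewrite ltr0n.
have le_ba : (b - a <= numCliqueEdgeCounts n r)%N.
  apply: numCliqueEdgeCounts_ge => m /andP[am mb].
  apply: clique_edge_count_interval zP => //; last first.
    by rewrite -tE; move: mb; rewrite bE; clear; lia.
  have := ltn_ceil (n ^ 2) r0.
  have := leq_mul (leqnn (2 * r)%N) am; rewrite aE.
  have := leq_pmull (r ^ 3) rp; have := leq_pmull r rp; clear.
  by move: (n ^ 2 %/ (2 * r))%N (n ^ 2)%N (r ^ 3)%N => u v w; lia.
have hab : b%:R - a%:R <= (numCliqueEdgeCounts n r)%:R :> R.
  by rewrite lerBlDr -natrD ler_nat addnC -leq_subLR.
apply: le_trans _ hab.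
have ha : a%:R <= n%:R ^+ 2 / (2 * r%:R) + (r ^ 3 + r + 1)%:R :> R.
  rewrite aE natrD lerD2r -natrX -natrM.
  by have /andP[] := natr_divn_bounds R (n ^ 2) r0.
have ht : n%:R ^+ 2 <= t%:R + 2 * n%:R + 2 * (r%:R * z%:R * n%:R) :> R.
  suff : (n ^ 2 <= t + 2 * n + 2 * (r * z * n))%N.
    by rewrite -(ler_nat R) natrX !natrD !natrM; lra.
  have : (r.-1 * z <= r * z)%N by rewrite leq_mul2r leq_pred orbT.
  rewrite tE; move: (r.-1 * z)%N (r * z)%N => u v uv; clear -uv.
  have := leq_mul uv (leqnn n); have [nu|nu] := leqP (1 + u) n; last first.
    have := leq_mul (leqnn n) (ltnW nu); move: ((n - 1 - u) ^ 2)%N; clear.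
    by lia.
  have [w wE] : exists w, n = (w + (1 + u))%N by exists (n - (1 + u))%N; rewrite subnK.
  have -> : (n - 1 - u = w)%N by rewrite -subnDA wE addnK.
  by rewrite wE; clear; nia.
have hb : (t%:R - n%:R) / 2 - 1 <= b%:R :> R.
  have /andP[h1 _] := natr_divn_bounds R (t - n) (isT : 0 < 2)%N.
  rewrite bE; apply: le_trans _ h1; rewrite lerD2r ler_pM2r ?invr_gt0 ?ltr0n //.
  by rewrite lerBlDr -natrD ler_nat; clear; lia.
have -> : (r ^ 3 + r + 3)%:R = (r ^ 3 + r + 1)%:R + 2 :> R
  by rewrite -natrD -[in RHS]addnA.
have n0 : 0 <= n%:R :> R by rewrite ler0n.
move: ha hb ht n0; move: (n%:R ^+ 2) (n%:R ^+ 2 / (2 * r%:R)) (r%:R * z%:R * n%:R) => u v w.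
by move: (r ^ 3 + r + 1)%N => k; lra.
Qed.

Theorem theorem4p2 (R : realType) (r : nat) (hr : (5 <= r)%N) :
  (fun n : nat => (numCliqueEdgeCounts n r)%:R : R)
    = (fun n : nat => n%:R ^+ 2 / 2 - n%:R ^+ 2 / (2 * r%:R) : R)
      +o_\oo (fun n : nat => n%:R ^+ 2 : R).
Proof.
apply/eqaddoP => eps eps0.
(* With [z = n %/ Q] the loss [r z n] is at most [(r / Q) n^2 <= (eps / 2) n^2]; the other half of
   [eps] absorbs [2 n + c] for large [n]. *)
have [Q QE0] : exists Q, Q = (Num.truncn (2 * r%:R / eps)).+1 by eexists.
have Qp : (0 < Q)%N by rewrite QE0.
have Q0 : 0 < Q%:R :> R by rewrite ltr0n.
have QE : r%:R / Q%:R <= eps / 2.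
  rewrite ler_pdivrMr //.
  have : 2 * r%:R / eps <= Q%:R by rewrite QE0 ltW // truncnS_gt.
  by rewrite ler_pdivrMr // mulrC; lra.
have [c cE] : exists c, c = (r ^ 3 + r + 3)%N by eexists.
near=> n.
rewrite !fctE [X in _ <= _ * X]ger0_norm ?exprn_ge0 ?ler0n //.
have n1 : 1 <= n%:R :> R by rewrite ler1n; near: n; exact: nbhs_infty_ge.
have nbig : 2 * (2 + c%:R) / eps <= n%:R :> R.
  by near: n; exact: nbhs_infty_ger.
have nQ : (Q * (6 * r.-1 * Q + 3 * r.-1 ^ 2) <= n)%N by near: n; exact: nbhs_infty_ge.
have err : 2 * n%:R + c%:R <= eps / 2 * n%:R ^+ 2.
  move: nbig; rewrite ler_pdivrMr // => h.
  apply: (@le_trans _ _ ((2 + c%:R) * n%:R)).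
    by rewrite [leRHS]mulrDl lerD2l ler_peMr // ler0n.
  by rewrite expr2 mulrA ler_wpM2r ?ler0n //; lra.
pose z := (n %/ Q)%N.
have zP : (6 * r.-1 * n + 3 * r.-1 ^ 2 <= 4 * z ^ 2)%N.
  have : (n < z.+1 * Q)%N by rewrite ltn_ceil.
  have : (6 * r.-1 * Q + 3 * r.-1 ^ 2 <= z)%N by rewrite leq_divRL // mulnC.
  have : (0 < r.-1)%N by clear -hr; lia.
  move: (r.-1) (z) (Q) => p z' Q'; clear => p0 hz hn.
  have := leq_mul hz (leqnn z'); have := leq_mul (leqnn (6 * p)%N) (ltnW hn).
  by nia.
have zn : r%:R * z%:R * n%:R <= eps / 2 * n%:R ^+ 2.
  rewrite expr2 mulrA ler_wpM2r ?ler0n //.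
  have /andP[_ hz] := natr_divn_bounds R n Qp.
  apply: (@le_trans _ _ (r%:R * (n%:R / Q%:R))); first by rewrite ler_wpM2l ?ler0n.
  by rewrite mulrCA mulrC ler_wpM2r ?ler0n.
have lo := @numCliqueEdgeCounts_lower R n r z hr zP.
have up := @numCliqueEdgeCounts_upper R n r (ltn_trans (isT : 0 < 4)%N hr).
have c3 : 3 <= c%:R :> R by rewrite ler_nat cE leq_addl.
have -> : eps * n%:R ^+ 2 = 2 * (eps / 2 * n%:R ^+ 2) by field.
rewrite ler_norml; move: lo up err zn c3 n1; rewrite -cE.
set u := n%:R ^+ 2 / 2 - n%:R ^+ 2 / (2 * r%:R).
set e := eps / 2 * n%:R ^+ 2; set w := r%:R * z%:R * n%:R.
by clearbody u e w; lra.
Unshelve. all: by end_near. Qed.
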